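(* Let $f(z)=\sum_{k\ge0}a_kz^k$ have finite radius of convergence $0<R<\infty$. If $f\in H^1(D_R)$ then $\kappa_*(n)\to\infty$ as $n\to\infty$. If moreover the radial boundary values $f(Re^{i\theta})=\lim_{r\to R}f(re^{i\theta})$ belong to the class $C^{k,\alpha}(C_R)$ (on the circle $C_R=\{|z|=R\}$), then there is a constant $c>0$ with $\kappa_*(n)\ge c\,n^{k+\alpha}$.
   Context: $M_1(r)=\frac{1}{2\pi}\int_0^{2\pi}|f(re^{i\theta})|\,d\theta$ for $0<r<R$, $M_1(R)=\|f\|_{H^1(D_R)}=\lim_{r\to R}M_1(r)$; $f\in H^1(D_R)$ means this is finite. $\kappa(n,r)=M_1(r)/(|a_n|r^n)$ (equal to $+\infty$ if $a_n=0$), and $\kappa_*(n)=\min_{0<r\le R}\kappa(n,r)$ is the optimal condition number. $C^{k,\alpha}$ denotes functions $k$ times continuously differentiable whose $k$-th derivative is Hölder continuous of order $0\le\alpha\le1$. *)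

(* Defs.v *)
From Stdlib Require Import Reals.
From Coquelicot Require Import Coquelicot.
Open Scope R_scope.

Definition cis (t : R) : C := (cos t, sin t).

(* Sum of the power series sum_k a_k z^k (componentwise real series;
   the series converges absolutely inside the disc of convergence). *)
Definition psum (a : nat -> C) (z : C) : C :=
  (Series (fun k => Re (a k * Cpow z k)%C), Series (fun k => Im (a k * Cpow z k)%C)).

Definition M1 (a : nat -> C) (r : R) : R :=
  / (2 * PI) * RInt (fun t => Cmod (psum a (r * cis t)%C)) 0 (2 * PI).

Definition M1_limit (a : nat -> C) (R0 L : R) : Prop :=
  filterlim (M1 a) (at_left R0) (locally L).

Definition in_H1 (a : nat -> C) (R0 : R) : Prop := exists L, M1_limit a R0 L.

(* M_1 extended to r = R by the value L = lim_{r->R^-} M_1(r) *)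
Definition M1ext (a : nat -> C) (R0 L r : R) : R :=
  if Rlt_dec r R0 then M1 a r else L.

Definition kappa (a : nat -> C) (R0 L : R) (n : nat) (r : R) : Rbar :=
  if Req_EM_T (Cmod (a n)) 0 then p_infty
  else Finite (M1ext a R0 L r / (Cmod (a n) * r ^ n)).

(* kappa_*(n) = min_{0<r<=R} kappa(n,r) >= M, stated as a lower bound on all r *)
Definition kappa_star_ge (a : nat -> C) (R0 L : R) (n : nat) (M : R) : Prop :=
  forall r, 0 < r <= R0 -> Rbar_le (Finite M) (kappa a R0 L n r).

Definition C_k_alpha (k : nat) (alpha : R) (g : R -> C) : Prop :=
  (forall t, g (t + 2 * PI) = g t) /\
  exists D : nat -> R -> C,
    D O = g /\
    (forall j t, (j < k)%nat -> is_derive (D j) t (D (S j) t)) /\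
    (forall t, continuous (D k) t) /\
    exists K, forall s t, Cmod (D k s - D k t)%C <= K * Rpower (Rabs (s - t)) alpha.

(* Main.v *)
Require Import Defs.
From Stdlib Require Import Reals Lra Lia ZArith Classical FunctionalExtensionality.
From Coquelicot Require Import Coquelicot.
Open Scope R_scope.

(** Write [b_n = a_n R0^n].  Cauchy's estimate [|a_m| r^m <= M1 r] for a fixed
    [a_m <> 0] gives [kappa n r >= |b_m| / |b_n|] for all [n >= m] and [r <= R0], so
    both claims are upper bounds on [|b_n|].

    [b_n -> 0] follows from Paley's inequality for lacunary coefficients of an [H^1]
    function.  Its test functions come from the Schur algorithm: starting from [0],
    compose Moebius maps [psi |-> (psi + conj zeta) / (1 + zeta psi)] with
    [zeta = b e^{int}] and [n] growing geometrically.  They stay bounded by 1, and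
    the only nonpositive frequencies of the result are the chosen [-n].

    If the radial limits [g] exist everywhere, then [g] has Fourier coefficients
    [b_n] by Riemann's uniqueness argument: for [phi = Re (- sum b_n e^{int} / n^2)]
    and [G'' = Re g - Re b_0], the function [phi - G] is affine, since otherwise
    (up to sign) a tilt of it has an interior maximum, where the Abel limit would be
    off.  Averages of Abel means are turned into second differences by the positive
    kernel [sum_n (1 + |n| x) e^{-|n| x} e^{ins}].  Integrating by parts [k + 2] times
    and using Hoelder continuity under a half-period shift bounds [|b_n|]. *)

(** * Series of functions on the circle *)

(** No convergence in [L^1] to boundary values is at hand: the data are a finite limit of [M1] and,
    in the second half, pointwise radial limits, with no domination that would let a limit pass
    under the integral. Hence lacunary test polynomials, paired with the series at radii below [R0],
    stand in for the Riemann-Lebesgue lemma. In the second half the coefficients of [g] must be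
    recovered from pointwise Abel limits, and dividing by [n^2] turns bounded coefficients into a
    uniformly convergent series.

    The Abel mean [u(x) = sum q_n e^{-nx}] pairs second differences with a second derivative of the
    Poisson kernel [P], whose sign varies, so a one-sided bound on second differences does not
    control it. The average [int_0^x y u(y) dy] pairs them with [P - x dP/dx]. This kernel is
    positive and, as [P] is odd in [x], its linear term cancels and its tail is of order [x^3]. A
    positive Abel limit makes the average of order [x^2], and the gap between the two powers is the
    contradiction. *)

Lemma sum_n_tail_small (B : nat -> R) (eps : R) :
  ex_series B -> 0 < eps ->
  exists N0, forall N, (N0 <= N)%nat -> Rabs (Series B - sum_n B N) < eps.
Proof.
  intros HB He.
  pose proof (Series_correct _ HB) as H.
  destruct (proj1 (filterlim_locally _ _) H (mkposreal eps He)) as [N0 HN].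
  exists N0; intros N HNN. specialize (HN N HNN).
  rewrite Rabs_minus_sym. exact HN.
Qed.

Lemma Series_sum_n_le (v B : nat -> R) (N : nat) :
  (forall k, Rabs (v k) <= B k) -> ex_series B ->
  Rabs (Series v - sum_n v N) <= Rabs (Series B - sum_n B N).
Proof.
  intros Hv HB.
  assert (Ha : ex_series (fun k => Rabs (v k))).
  { apply (ex_series_le (V := R_CompleteNormedModule) _ B); [|exact HB].
    intros k. unfold norm; simpl; unfold abs; simpl. rewrite Rabs_Rabsolu. apply Hv. }
  rewrite (Series_incr_n v (S N)) by (try lia; apply ex_series_Rabs, Ha).
  rewrite (Series_incr_n B (S N)) by (try lia; exact HB).
  simpl pred. rewrite <- !sum_n_Reals.
  assert (HaS : ex_series (fun k => Rabs (v (S N + k)%nat)))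
    by (apply (ex_series_incr_n (fun k => Rabs (v k)) (S N)), Ha).
  assert (HBS : ex_series (fun k => B (S N + k)%nat)) by (apply (ex_series_incr_n B (S N)), HB).
  match goal with |- Rabs (?a + ?b - ?a) <= Rabs (?c + ?d - ?c) =>
    replace (a + b - a) with b by ring; replace (c + d - c) with d by ring end.
  apply Rle_trans with (2 := Rle_abs _).
  apply Rle_trans with (1 := Series_Rabs _ HaS).
  apply Series_le; [|exact HBS].
  intros k; split; [apply Rabs_pos | apply Hv].
Qed.

(** The Weierstrass M-test: the tail of the majorant bounds the remainder, so one [N0] serves every
    [t]. *)
Lemma Mtest_approx (u : nat -> R -> R) (B : nat -> R) (eps : R) :
  (forall k t, Rabs (u k t) <= B k) -> ex_series B -> 0 < eps ->
  exists N0, forall N t, (N0 <= N)%nat ->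
    Rabs (Series (fun k => u k t) - sum_n (fun k => u k t) N) < eps.
Proof.
  intros Hu HB He.
  destruct (sum_n_tail_small B eps HB He) as [N0 HN].
  exists N0; intros N t HNN.
  apply Rle_lt_trans with (2 := HN N HNN).
  apply Series_sum_n_le; auto.
Qed.

Lemma continuous_sum_n (u : nat -> R -> R) (N : nat) (t : R) :
  (forall k, continuous (u k) t) -> continuous (fun s => sum_n (fun k => u k s) N) t.
Proof.
  intros H. induction N as [|N IH].
  - apply continuous_ext with (u 0%nat); [intros s; now rewrite sum_O | apply H].
  - apply continuous_ext with (fun s => plus (sum_n (fun k => u k s) N) (u (S N) s)).
    + intros s; now rewrite sum_Sn.
    + apply (continuous_plus (fun s => sum_n (fun k => u k s) N) (u (S N))); auto.
Qed.

Lemma Mtest_continuous (u : nat -> R -> R) (B : nat -> R) :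
  (forall k t, Rabs (u k t) <= B k) -> ex_series B ->
  (forall k t, continuous (u k) t) ->
  forall t, continuous (fun s => Series (fun k => u k s)) t.
Proof.
  intros Hu HB Hc t. apply filterlim_locally. intros eps.
  destruct (Mtest_approx u B (eps / 3) Hu HB) as [N HN];
    [destruct eps; simpl; lra|].
  assert (H := continuous_sum_n u N t (fun k => Hc k t)).
  assert (He : 0 < eps / 3) by (destruct eps; simpl; lra).
  generalize (proj1 (filterlim_locally _ _) H (mkposreal _ He)).
  apply filter_imp. intros s Hs.
  unfold ball in Hs |- *; simpl in Hs |- *; unfold AbsRing_ball, abs, minus, plus, opp in Hs |- *;
    simpl in Hs |- *.
  generalize (HN N s (le_n _)) (HN N t (le_n _)).
  intros H1 H2. apply Rabs_def2 in H1, H2, Hs. apply Rabs_def1; lra.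
Qed.

Lemma ex_RInt_cont (f : R -> R) (a b : R) :
  (forall t, continuous f t) -> ex_RInt f a b.
Proof. intros H; apply (ex_RInt_continuous (V := R_CompleteNormedModule)); intros; apply H. Qed.

Lemma RInt_sum_n (u : nat -> R -> R) (N : nat) (a b : R) :
  (forall k t, continuous (u k) t) ->
  RInt (fun t => sum_n (fun k => u k t) N) a b = sum_n (fun k => RInt (u k) a b) N.
Proof.
  intros H. induction N as [|N IH].
  - rewrite sum_O. apply RInt_ext; intros; now rewrite sum_O.
  - rewrite sum_Sn, <- IH, <- RInt_plus.
    + apply RInt_ext; intros; now rewrite sum_Sn.
    + apply ex_RInt_cont; intros; now apply continuous_sum_n.
    + apply ex_RInt_cont, H.
Qed.

Lemma Mtest_RInt (u : nat -> R -> R) (B : nat -> R) (a b : R) :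
  a <= b ->
  (forall k t, Rabs (u k t) <= B k) -> ex_series B ->
  (forall k t, continuous (u k) t) ->
  is_series (fun k => RInt (u k) a b) (RInt (fun t => Series (fun k => u k t)) a b).
Proof.
  intros Hab Hu HB Hc. apply filterlim_locally. intros eps.
  assert (He : 0 < eps / (b - a + 1)) by (apply Rdiv_lt_0_compat; [apply eps | lra]).
  destruct (Mtest_approx u B _ Hu HB He) as [N0 HN].
  exists N0; intros N HNN.
  rewrite <- RInt_sum_n by exact Hc.
  unfold ball; simpl; unfold AbsRing_ball, abs, minus, plus, opp; simpl.
  change (Rabs (RInt (fun t => sum_n (fun k => u k t) N) a b
                - RInt (fun t => Series (fun k => u k t)) a b) < eps).
  rewrite Rabs_minus_sym.
  rewrite <- (RInt_minus (V := R_CompleteNormedModule)).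
  2: apply ex_RInt_cont; intros t; apply (Mtest_continuous u B); auto.
  2: apply ex_RInt_cont; intros t; apply continuous_sum_n; auto.
  apply Rle_lt_trans with ((b - a) * (eps / (b - a + 1))).
  - apply abs_RInt_le_const; auto.
    + apply ex_RInt_cont; intros t.
      apply (continuous_minus (fun s => Series (fun k => u k s)) (fun s => sum_n (fun k => u k s) N));
      [apply (Mtest_continuous u B) | apply continuous_sum_n]; auto.
    + intros t _. left. apply HN, HNN.
  - assert (H0 : (b - a + 1) * (eps / (b - a + 1)) = eps) by (field; lra). nra.
Qed.

(** * Characters of the circle *)

Lemma cis_0 : cis 0 = 1%C.
Proof. unfold cis; now rewrite cos_0, sin_0. Qed.

Lemma cis_plus (s t : R) : cis (s + t) = (cis s * cis t)%C.
Proof. unfold cis, Cmult; simpl. rewrite cos_plus, sin_plus. f_equal. ring. Qed.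

Lemma Cpow_cis (n : nat) (t : R) : Cpow (cis t) n = cis (INR n * t).
Proof.
  induction n as [|n IH].
  - simpl. now rewrite Rmult_0_l, cis_0.
  - rewrite Cpow_S, IH, S_INR, <- cis_plus. f_equal; ring.
Qed.

Lemma Cmod_cis (t : R) : Cmod (cis t) = 1.
Proof.
  unfold cis, Cmod; simpl. transitivity (sqrt 1); [f_equal | apply sqrt_1].
  generalize (sin2_cos2 t); unfold Rsqr; lra.
Qed.

Lemma cis_2PI (k : Z) (t : R) : cis (t + 2 * IZR k * PI) = cis t.
Proof.
  assert (P : forall (n : nat) s, cis (s + 2 * INR n * PI) = cis s).
  { intros n s; unfold cis. now rewrite cos_period, sin_period. }
  destruct (Z.le_gt_cases 0 k) as [H|H].
  - rewrite <- (Z2Nat.id k H), <- INR_IZR_INZ. apply P.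
  - rewrite <- (P (Z.to_nat (- k)) (t + _)). f_equal.
    rewrite INR_IZR_INZ, Z2Nat.id, opp_IZR by lia. ring.
Qed.

Lemma Re_mult_cis (w : C) (t : R) : Re (w * cis t) = Re w * cos t - Im w * sin t.
Proof. unfold cis. rewrite re_mult; reflexivity. Qed.

Lemma continuous_Re_cis (w : C) (m t : R) :
  continuous (fun s => Re (w * cis (m * s))) t.
Proof.
  apply continuous_ext with (fun s => Re w * cos (m * s) - Im w * sin (m * s)).
  { intros s; now rewrite Re_mult_cis. }
  apply (ex_derive_continuous (fun s => Re w * cos (m * s) - Im w * sin (m * s))).
  auto_derive; auto.
Qed.

Lemma RInt_Re_cis (w : C) (m : Z) (a : R) : m <> 0%Z ->
  RInt (fun t => Re (w * cis (IZR m * t))) a (a + 2 * PI) = 0.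
Proof.
  intros Hm.
  assert (Hm' : IZR m <> 0) by (now apply not_0_IZR).
  set (P := fun t => (Re w * sin (IZR m * t) + Im w * cos (IZR m * t)) / IZR m).
  assert (H : is_RInt (fun t => Re (w * cis (IZR m * t))) a (a + 2 * PI)
     (minus (P (a + 2 * PI)) (P a))).
  { apply (is_RInt_derive P (fun t => Re (w * cis (IZR m * t)))).
    - intros t _. unfold P. rewrite Re_mult_cis.
      auto_derive; auto. field; auto.
    - intros t _. apply continuous_Re_cis. }
  rewrite (is_RInt_unique _ _ _ _ H).
  assert (E := cis_2PI m (IZR m * a)). unfold cis in E. injection E; intros E1 E2.
  unfold P, minus, plus, opp; simpl.
  replace (IZR m * (a + 2 * PI)) with (IZR m * a + 2 * IZR m * PI) by ring.
  rewrite E1, E2. ring.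
Qed.

Lemma RInt_const_2PI (c a : R) : RInt (fun _ => c) a (a + 2 * PI) = 2 * PI * c.
Proof. rewrite RInt_const. unfold scal; simpl; unfold mult; simpl. ring. Qed.

Lemma Re_Cmult_le (z w : C) : Rabs (Re (z * w)) <= Cmod z * Cmod w.
Proof. rewrite <- Cmod_mult. apply re_le_Cmod. Qed.

Lemma im_le_Cmod (z : C) : Rabs (Im z) <= Cmod z.
Proof. apply Rle_trans with (2 := Rmax_Cmod z). apply Rmax_r. Qed.

(** All integrals below are of real functions, so a modulus is reached as the real part of a product
    with a unimodular [w]. *)
Lemma phase_exists (z : C) : exists w : C, Cmod w = 1 /\ (z * w)%C = RtoC (Cmod z).
Proof.
  destruct (Req_dec (Cmod z) 0) as [H|H].
  - exists 1%C. split; [apply Cmod_1|]. rewrite (Cmod_eq_0 z H), Cmod_0. ring.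
  - assert (Hz : RtoC (Cmod z) <> 0%C) by (intros E; apply RtoC_inj in E; auto).
    exists (Cconj z / RtoC (Cmod z))%C. split.
    + rewrite Cmod_div, Cmod_conj, Cmod_R, Rabs_pos_eq by (auto; apply Cmod_ge_0).
      field; auto.
    + unfold Cdiv. rewrite Cmult_assoc, <- Cmod2_conj.
      rewrite RtoC_pow. field; auto.
Qed.

(** * Pairing with trigonometric polynomials and the Schur algorithm *)

Definition summable (c : nat -> C) : Prop := ex_series (fun k => Cmod (c k)).

Lemma ex_series_dom (v B : nat -> R) :
  (forall k, Rabs (v k) <= B k) -> ex_series B -> ex_series v.
Proof. intros H HB. apply (ex_series_le (V := R_CompleteNormedModule) _ B); auto. Qed.

Lemma psum_scale (a : nat -> C) (r : R) (z : C) :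
  psum a (r * z) = psum (fun k => a k * RtoC (r ^ k))%C z.
Proof.
  unfold psum. f_equal; apply Series_ext; intros k; f_equal;
  rewrite Cpow_mult_l, <- RtoC_pow; ring.
Qed.

Lemma Re_psum_cis (c : nat -> C) (t : R) (v : C) :
  summable c ->
  Re (psum c (cis t) * v) = Series (fun k => Re (c k * v * cis (INR k * t))).
Proof.
  intros Hc. rewrite re_mult.
  change (Re (psum c (cis t))) with (Series (fun k => Re (c k * Cpow (cis t) k))).
  change (Im (psum c (cis t))) with (Series (fun k => Im (c k * Cpow (cis t) k))).
  assert (B : forall k, Cmod (c k * Cpow (cis t) k) <= Cmod (c k)).
  { intros k. rewrite Cmod_mult, Cmod_pow, Cmod_cis, pow1. lra. }
  rewrite <- !Series_scal_r, <- Series_minus.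
  - apply Series_ext; intros k. rewrite <- re_mult, Cpow_cis. f_equal. ring.
  - apply ex_series_scal_r, (ex_series_dom _ _ (fun k => Rle_trans _ _ _ (re_le_Cmod _) (B k)) Hc).
  - apply ex_series_scal_r, (ex_series_dom _ _ (fun k => Rle_trans _ _ _ (im_le_Cmod _) (B k)) Hc).
Qed.

Lemma Re_mult_cis_le (w : C) (t : R) : Rabs (Re (w * cis t)) <= Cmod w.
Proof. generalize (Re_Cmult_le w (cis t)). rewrite Cmod_cis; lra. Qed.

Lemma continuous_Re_psum (c : nat -> C) (v : C) (t : R) :
  summable c -> continuous (fun s => Re (psum c (cis s) * v)) t.
Proof.
  intros Hc.
  apply continuous_ext with (fun s => Series (fun k => Re (c k * v * cis (INR k * s)))).
  { intros s; now rewrite Re_psum_cis. }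
  apply (Mtest_continuous (fun k s => Re (c k * v * cis (INR k * s)))
           (fun k => Cmod (c k) * Cmod v)).
  - intros k s. rewrite <- Cmod_mult. apply Re_mult_cis_le.
  - apply ex_series_scal_r, Hc.
  - intros k s. apply continuous_Re_cis.
Qed.

Lemma continuous_Cmod_psum (c : nat -> C) (t : R) :
  summable c -> continuous (fun s => Cmod (psum c (cis s))) t.
Proof.
  intros Hc. unfold Cmod.
  apply (continuous_comp (fun s => fst (psum c (cis s)) ^ 2 + snd (psum c (cis s)) ^ 2) sqrt).
  2: apply continuous_sqrt.
  assert (H1 : continuous (fun s => fst (psum c (cis s))) t).
  { apply continuous_ext with (2 := continuous_Re_psum c 1 t Hc).
    intros s; now rewrite Cmult_1_r. }
  assert (H2 : continuous (fun s => snd (psum c (cis s))) t).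
  { apply continuous_ext with (2 := continuous_Re_psum c (- Ci) t Hc).
    intros s. rewrite re_mult. simpl. unfold Re, Im. simpl. ring. }
  apply (continuous_plus (fun s => fst (psum c (cis s)) ^ 2) (fun s => snd (psum c (cis s)) ^ 2)).
  - apply continuous_ext with (fun s => mult (fst (psum c (cis s))) (fst (psum c (cis s)))).
    { intros s; unfold mult; simpl; ring. }
    now apply (continuous_mult (K := R_AbsRing)).
  - apply continuous_ext with (fun s => mult (snd (psum c (cis s))) (snd (psum c (cis s)))).
    { intros s; unfold mult; simpl; ring. }
    now apply (continuous_mult (K := R_AbsRing)).
Qed.

(** Trigonometric polynomials with all frequencies at least [N]. Being generated by monomials and
    sums, they admit proofs by induction, and products only add the lower bounds; no coefficients
    are tracked. *)
Inductive trig (N : Z) : (R -> C) -> Prop :=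
| trig_mono (w : C) (m : Z) : (N <= m)%Z -> trig N (fun t => w * cis (IZR m * t))%C
| trig_plus (f g : R -> C) : trig N f -> trig N g -> trig N (fun t => f t + g t)%C.

Lemma trig_ext (N : Z) (f g : R -> C) : (forall t, f t = g t) -> trig N f -> trig N g.
Proof. intros H Hf. now rewrite <- (functional_extensionality _ _ H). Qed.

Lemma trig_le (M N : Z) (f : R -> C) : (M <= N)%Z -> trig N f -> trig M f.
Proof.
  intros H; induction 1; [apply trig_mono; lia | now apply trig_plus].
Qed.

Lemma trig_mult (M N : Z) (f g : R -> C) :
  trig M f -> trig N g -> trig (M + N) (fun t => f t * g t)%C.
Proof.
  intros Hf Hg. induction Hf as [w m Hm | f1 f2 H1 IH1 H2 IH2].
  - induction Hg as [v k Hk | g1 g2 H1 IH1 H2 IH2].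
    + apply trig_ext with (fun t => (w * v) * cis (IZR (m + k) * t))%C.
      * intros t. rewrite plus_IZR, Rmult_plus_distr_r, cis_plus. ring.
      * apply trig_mono. lia.
    + eapply trig_ext; [| exact (trig_plus _ _ _ IH1 IH2)]. intros t; simpl; ring.
  - eapply trig_ext; [| exact (trig_plus _ _ _ IH1 IH2)]. intros t; simpl; ring.
Qed.

Lemma trig_const (w : C) : trig 0 (fun _ => w).
Proof.
  apply trig_ext with (fun t => w * cis (IZR 0 * t))%C; [|apply trig_mono; lia].
  intros t. rewrite Rmult_0_l, cis_0. ring.
Qed.

Lemma trig_scal (N : Z) (w : C) (f : R -> C) : trig N f -> trig N (fun t => w * f t)%C.
Proof. intros H. apply (trig_mult 0 N _ _ (trig_const w) H). Qed.

(** Bilinear, without conjugation: the frequency [-n] of [psi] meets the coefficient [c n]. *)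
Definition pairing (c : nat -> C) (psi : R -> C) : R :=
  RInt (fun t => Re (psum c (cis t) * psi t)) 0 (2 * PI).

Lemma Re_psum_mono (c : nat -> C) (w : C) (m : Z) (t : R) :
  summable c ->
  Re (psum c (cis t) * (w * cis (IZR m * t))) =
  Series (fun k => Re (c k * w * cis (IZR (Z.of_nat k + m) * t))).
Proof.
  intros Hc. rewrite Re_psum_cis by exact Hc. apply Series_ext; intros k.
  rewrite plus_IZR, <- INR_IZR_INZ, Rmult_plus_distr_r, cis_plus. f_equal; ring.
Qed.

Lemma continuous_pairing (c : nat -> C) (N : Z) (psi : R -> C) (t : R) :
  summable c -> trig N psi -> continuous (fun s => Re (psum c (cis s) * psi s)) t.
Proof.
  intros Hc. induction 1 as [w m Hm | f g H1 IH1 H2 IH2].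
  - apply continuous_ext with
      (fun s => Series (fun k => Re (c k * w * cis (IZR (Z.of_nat k + m) * s)))).
    { intros s; now rewrite Re_psum_mono. }
    apply (Mtest_continuous (fun k s => Re (c k * w * cis (IZR (Z.of_nat k + m) * s)))
             (fun k => Cmod (c k) * Cmod w)).
    + intros k s. rewrite <- Cmod_mult. apply Re_mult_cis_le.
    + apply ex_series_scal_r, Hc.
    + intros k s. apply continuous_Re_cis.
  - apply continuous_ext with
      (fun s => plus (Re (psum c (cis s) * f s)) (Re (psum c (cis s) * g s))).
    + intros s. rewrite Cmult_plus_distr_l. reflexivity.
    + now apply (continuous_plus (fun s => Re (psum c (cis s) * f s))
                   (fun s => Re (psum c (cis s) * g s))).
Qed.

Lemma is_series_single (f : nat -> R) (n : nat) :
  (forall k, k <> n -> f k = 0) -> is_series f (f n).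
Proof.
  intros H. apply filterlim_ext_loc with (fun _ => f n); [|apply filterlim_const].
  assert (E : forall N, sum_n f N = if le_dec n N then f n else 0).
  { induction N as [|N IH].
    - rewrite sum_O. destruct (le_dec n 0) as [h|h].
      + now replace n with 0%nat by lia.
      + apply H; lia.
    - rewrite sum_Sn, IH. unfold plus; simpl.
      destruct (le_dec n N), (le_dec n (S N)); try lia.
      + rewrite (H (S N)) by lia; ring.
      + replace n with (S N) by lia; ring.
      + rewrite (H (S N)) by lia; ring. }
  exists n; intros N HN. rewrite E. destruct (le_dec n N); [easy|lia].
Qed.

Lemma pairing_mono (c : nat -> C) (w : C) (m : Z) :
  summable c ->
  is_series (fun k => RInt (fun t => Re (c k * w * cis (IZR (Z.of_nat k + m) * t))) 0 (2 * PI))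
    (pairing c (fun t => w * cis (IZR m * t))%C).
Proof.
  intros Hc. unfold pairing.
  rewrite (RInt_ext _ (fun t => Series (fun k => Re (c k * w * cis (IZR (Z.of_nat k + m) * t)))))
    by (intros t _; now apply Re_psum_mono).
  apply (Mtest_RInt (fun k s => Re (c k * w * cis (IZR (Z.of_nat k + m) * s)))
             (fun k => Cmod (c k) * Cmod w)).
  - generalize PI_RGT_0; lra.
  - intros k s. rewrite <- Cmod_mult. apply Re_mult_cis_le.
  - apply ex_series_scal_r, Hc.
  - intros k s. apply continuous_Re_cis.
Qed.

Lemma RInt_Re_cis_0 (w : C) (m : Z) : m <> 0%Z ->
  RInt (fun t => Re (w * cis (IZR m * t))) 0 (2 * PI) = 0.
Proof.
  intros Hm. replace (2 * PI) with (0 + 2 * PI) by ring. now apply RInt_Re_cis.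
Qed.

Lemma pairing_coef (c : nat -> C) (w : C) (n : nat) :
  summable c -> pairing c (fun t => w * cis (- INR n * t))%C = 2 * PI * Re (c n * w).
Proof.
  intros Hc. rewrite INR_IZR_INZ, <- opp_IZR.
  rewrite <- (is_series_unique _ _ (pairing_mono c w (- Z.of_nat n) Hc)).
  match goal with |- Series ?f = _ => assert (H : forall k, k <> n -> f k = 0);
    [| rewrite (is_series_unique _ _ (is_series_single f n H))] end.
  - intros k Hk. apply RInt_Re_cis_0. lia.
  - rewrite Z.add_opp_diag_r.
    rewrite (RInt_ext _ (fun _ => Re (c n * w))).
    + replace (2 * PI) with (0 + 2 * PI) at 1 by ring. apply RInt_const_2PI.
    + intros t _. rewrite Rmult_0_l, cis_0, Cmult_1_r. reflexivity.
Qed.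

Lemma pairing_plus (c : nat -> C) (M N : Z) (f g : R -> C) :
  summable c -> trig M f -> trig N g ->
  pairing c (fun t => f t + g t)%C = pairing c f + pairing c g.
Proof.
  intros Hc Hf Hg. unfold pairing.
  rewrite <- (RInt_plus (V := R_CompleteNormedModule)).
  - apply RInt_ext; intros t _. rewrite Cmult_plus_distr_l. reflexivity.
  - apply ex_RInt_cont; intros t. now apply continuous_pairing with M.
  - apply ex_RInt_cont; intros t. now apply continuous_pairing with N.
Qed.

Lemma pairing_scal (c : nat -> C) (N : Z) (x : R) (f : R -> C) :
  summable c -> trig N f -> pairing c (fun t => x * f t)%C = x * pairing c f.
Proof.
  intros Hc Hf. unfold pairing.
  rewrite <- (RInt_scal (V := R_CompleteNormedModule) (fun t => Re (psum c (cis t) * f t))).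
  - apply RInt_ext; intros t _.
    change (Re (psum c (cis t) * (x * f t)) = x * Re (psum c (cis t) * f t)).
    rewrite !re_mult, im_mult. simpl. ring.
  - apply ex_RInt_cont; intros t. now apply continuous_pairing with N.
Qed.

(** The power series has frequencies [k >= 0], so every product has a frequency [k + m >= 1] and
    integrates to 0. A test function may therefore be altered freely in its positive frequencies. *)
Lemma pairing_trig_1 (c : nat -> C) (f : R -> C) : summable c -> trig 1 f -> pairing c f = 0.
Proof.
  intros Hc. induction 1 as [w m Hm | f g H1 IH1 H2 IH2].
  - rewrite <- (is_series_unique _ _ (pairing_mono c w m Hc)).
    rewrite (Series_ext _ (fun _ => 0 * 0)).
    + rewrite Series_scal_l. ring.
    + intros k. rewrite Rmult_0_l. apply RInt_Re_cis_0. lia.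
  - rewrite (pairing_plus c 1 1) by easy. lra.
Qed.

Lemma pairing_le (c : nat -> C) (N : Z) (f : R -> C) :
  summable c -> trig N f -> (forall t, Cmod (f t) <= 1) ->
  pairing c f <= RInt (fun t => Cmod (psum c (cis t))) 0 (2 * PI).
Proof.
  intros Hc Hf H1. apply RInt_le.
  - generalize PI_RGT_0; lra.
  - apply ex_RInt_cont; intros t. now apply continuous_pairing with N.
  - apply ex_RInt_cont; intros t. now apply continuous_Cmod_psum.
  - intros t _. apply Rle_trans with (1 := Rle_abs _).
    apply Rle_trans with (1 := Re_Cmult_le _ _).
    generalize (H1 t) (Cmod_ge_0 (psum c (cis t))) (Cmod_ge_0 (f t)). nra.
Qed.

(** Cauchy's estimate, by testing against [w e^{-int}] with [w] the phase of [c n]. *)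
Lemma Cmod_coef_le (c : nat -> C) (n : nat) :
  summable c ->
  2 * PI * Cmod (c n) <= RInt (fun t => Cmod (psum c (cis t))) 0 (2 * PI).
Proof.
  intros Hc. destruct (phase_exists (c n)) as [w [Hw Ew]].
  replace (Cmod (c n)) with (Re (c n * w)) by (now rewrite Ew).
  rewrite <- pairing_coef by exact Hc.
  rewrite INR_IZR_INZ, <- opp_IZR.
  apply (pairing_le c (- Z.of_nat n)); [easy | apply trig_mono; lia |].
  intros t. rewrite Cmod_mult, Cmod_cis, Hw. lra.
Qed.

(** * The Schur algorithm and Paley's lacunary test functions *)

(** The difference of the squares of the two sides is [(1 - |psi|^2) (1 - |zeta|^2)]. *)
Lemma moebius_le (psi zeta : C) :
  Cmod psi <= 1 -> Cmod zeta <= 1 -> Cmod (psi + Cconj zeta) <= Cmod (1 + zeta * psi).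
Proof.
  intros Hp Hz.
  apply Rsqr_incr_0; try apply Cmod_ge_0.
  rewrite !Rsqr_pow2, !Cmod2_alt.
  assert (Hp' : 0 <= 1 - Cmod psi ^ 2) by (generalize (Cmod_ge_0 psi); nra).
  assert (Hz' : 0 <= 1 - Cmod zeta ^ 2) by (generalize (Cmod_ge_0 zeta); nra).
  assert (H := Rmult_le_pos _ _ Hp' Hz'). rewrite !Cmod2_alt in H.
  destruct psi as [p q], zeta as [a b]. simpl in *. nra.
Qed.

(** The sum of [psi (- zeta psi)^j] over [j <= M], a truncation of [psi / (1 + zeta psi)] that is
    still a trigonometric polynomial. The Moebius image is [conj zeta + (1 - |zeta|^2) psi / (1 +
    zeta psi)]. *)
Fixpoint schur_iter (zeta psi : R -> C) (M : nat) (t : R) : C :=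
  match M with
  | O => psi t
  | S M => psi t - zeta t * psi t * schur_iter zeta psi M t
  end%C.

Lemma schur_iter_closed (zeta psi : R -> C) (M : nat) (t : R) :
  ((1 + zeta t * psi t) * schur_iter zeta psi M t =
   psi t * (1 - Cpow (- (zeta t * psi t)) (S M)))%C.
Proof.
  induction M as [|M IH].
  - simpl. ring.
  - cbn [schur_iter].
    transitivity ((1 + zeta t * psi t) * psi t
      - zeta t * psi t * ((1 + zeta t * psi t) * schur_iter zeta psi M t))%C; [ring|].
    rewrite IH, (Cpow_S _ (S M)). ring.
Qed.

(** Every term after [psi] contains [zeta psi psi], of frequency at least [n - 2 N]; the gap
    [2 N + 1 <= n] makes this positive. *)
Lemma schur_iter_trig (zeta psi : R -> C) (N n : Z) (M : nat) :
  (0 <= N)%Z -> (2 * N + 1 <= n)%Z -> trig n zeta -> trig (- N) psi ->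
  exists rho, trig 1 rho /\ forall t, schur_iter zeta psi M t = (psi t + rho t)%C.
Proof.
  intros HN0 HN Hz Hp. induction M as [|M [rho [Hr IH]]].
  - exists (fun t => 0 * cis (IZR 1 * t))%C. split; [apply trig_mono; lia|].
    intros t; simpl; ring.
  - exists (fun t => RtoC (-1) * ((zeta t * psi t) * psi t + (zeta t * psi t) * rho t))%C. split.
    + apply trig_scal.
      assert (Hzp := trig_mult _ _ _ _ Hz Hp).
      apply trig_plus.
      * apply trig_le with (2 := trig_mult _ _ _ _ Hzp Hp). lia.
      * apply trig_le with (2 := trig_mult _ _ _ _ Hzp Hr). lia.
    + intros t. cbn [schur_iter]. rewrite IH. ring.
Qed.

(* One step of the Schur algorithm: the Moebius image
   [(psi + conj zeta) / (1 + zeta psi)] is still bounded by 1, and its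
   expansion only adds strictly positive frequencies to
   [conj zeta + (1 - beta^2) psi].  Truncating the geometric series costs the
   outer factor [1 - beta^2]. *)
Lemma schur_step (beta : R) (b : C) (psi : R -> C) (N n : nat) :
  0 < beta < 1 -> Cmod b = beta -> (2 * N + 1 <= n)%nat ->
  trig (- Z.of_nat N) psi -> (forall t, Cmod (psi t) <= 1) ->
  exists psi', trig (- Z.of_nat n) psi' /\ (forall t, Cmod (psi' t) <= 1) /\
    forall c, summable c ->
      pairing c psi' =
      (1 - beta ^ 2) * (2 * PI * Re (c n * Cconj b) + (1 - beta ^ 2) * pairing c psi).
Proof.
  intros Hb Hbb Hn Hp H1.
  set (zeta := fun t => (b * cis (IZR (Z.of_nat n) * t))%C).
  set (zbar := fun t => (Cconj b * cis (IZR (- Z.of_nat n) * t))%C).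
  assert (Ez : forall t, zbar t = Cconj (zeta t)).
  { intros t. unfold zbar, zeta. rewrite Cmult_conj. f_equal.
    rewrite opp_IZR. unfold cis, Cconj; simpl.
    rewrite <- Ropp_mult_distr_l, cos_neg, sin_neg. reflexivity. }
  assert (Mz : forall t, Cmod (zeta t) = beta).
  { intros t. unfold zeta. now rewrite Cmod_mult, Cmod_cis, Hbb, Rmult_1_r. }
  assert (Tz : trig (Z.of_nat n) zeta) by (apply trig_mono; lia).
  assert (Tzb : trig (- Z.of_nat n) zbar) by (apply trig_mono; lia).
  (* With [2 beta^(M+1) <= beta^2], the truncated image has modulus at most [1 + beta^2], and the
     outer factor brings it to [(1 - beta^2) (1 + beta^2) <= 1]. *)
  destruct (pow_lt_1_zero beta) with (y := beta ^ 2 / 2) as [M HM].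
  { rewrite Rabs_pos_eq; lra. } { nra. }
  specialize (HM (S M) ltac:(lia)). rewrite Rabs_pos_eq in HM by (apply pow_le; lra).
  destruct (schur_iter_trig zeta psi (Z.of_nat N) (Z.of_nat n) M) as [rho [Hr Er]];
    auto; try lia.
  set (T := fun t => (zbar t + RtoC (1 - beta ^ 2) * (psi t + rho t))%C).
  assert (Hpn : trig (- Z.of_nat n) psi) by (apply trig_le with (2 := Hp); lia).
  assert (Hrn : trig (- Z.of_nat n) rho) by (apply trig_le with (2 := Hr); lia).
  assert (TT : trig (- Z.of_nat n) T).
  { apply trig_plus; auto. apply trig_scal, trig_plus; auto. }
  exists (fun t => RtoC (1 - beta ^ 2) * T t)%C. split; [|split].
  - now apply trig_scal.
  - intros t. rewrite Cmod_mult, Cmod_R, Rabs_pos_eq by nra.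
    enough (Cmod (T t) <= 1 + 2 * beta ^ S M).
    { generalize (Cmod_ge_0 (T t)). assert (0 < beta ^ 2 < 1) by nra. nra. }
    set (D := (1 + zeta t * psi t)%C).
    assert (HD : 1 - beta <= Cmod D).
    { assert (H := Cmod_triangle D (- (zeta t * psi t))).
      replace (D + - (zeta t * psi t))%C with (RtoC 1) in H by (unfold D; ring).
      rewrite Cmod_1, Cmod_opp, Cmod_mult, Mz in H.
      generalize (H1 t) (Cmod_ge_0 (psi t)). nra. }
    assert (E : (D * T t = (psi t + Cconj (zeta t))
       + - (RtoC (1 - beta ^ 2) * psi t * Cpow (- (zeta t * psi t)) (S M)))%C).
    { unfold T. rewrite <- Er, Ez.
      transitivity (D * Cconj (zeta t)
        + RtoC (1 - beta ^ 2) * (D * schur_iter zeta psi M t))%C; [ring|].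
      unfold D. rewrite schur_iter_closed.
      replace (RtoC (1 - beta ^ 2)) with (1 - zeta t * Cconj (zeta t))%C; [ring|].
      rewrite <- Cmod2_conj, Mz, RtoC_minus, RtoC_pow. reflexivity. }
    assert (F : Cmod D * Cmod (T t) <= Cmod D + (1 - beta ^ 2) * beta ^ S M).
    { rewrite <- Cmod_mult, E. apply Rle_trans with (1 := Cmod_triangle _ _).
      apply Rplus_le_compat.
      - apply moebius_le; auto. rewrite Mz; lra.
      - rewrite Cmod_opp, !Cmod_mult, Cmod_pow, Cmod_opp, Cmod_mult, Mz, Cmod_R.
        rewrite Rabs_pos_eq by nra.
        assert (G : (beta * Cmod (psi t)) ^ S M <= beta ^ S M).
        { apply pow_incr. generalize (H1 t) (Cmod_ge_0 (psi t)). nra. }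
        assert (G0 : 0 <= (beta * Cmod (psi t)) ^ S M).
        { apply pow_le. generalize (Cmod_ge_0 (psi t)). nra. }
        rewrite Rmult_assoc. apply Rmult_le_compat_l; [nra|].
        generalize (H1 t) (Cmod_ge_0 (psi t)). nra. }
    assert (P : 0 < beta ^ S M) by (apply pow_lt; lra).
    apply Rmult_le_reg_l with (Cmod D); [lra|].
    apply Rle_trans with (1 := F).
    (* [1 - beta^2 = (1 - beta) (1 + beta) <= 2 (1 - beta) <= 2 |D|]. *)
    assert ((1 - beta ^ 2) * beta ^ S M <= Cmod D * (2 * beta ^ S M)); [|lra].
    replace (Cmod D * (2 * beta ^ S M)) with (2 * Cmod D * beta ^ S M) by ring.
    apply Rmult_le_compat_r; [lra|]. nra.
  - intros c Hc. rewrite (pairing_scal c _ _ _ Hc TT). f_equal.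
    unfold T. rewrite (pairing_plus c (- Z.of_nat n) (- Z.of_nat n)); auto.
    + f_equal.
      * rewrite <- (pairing_coef c (Cconj b) n Hc). unfold zbar.
        rewrite opp_IZR, <- INR_IZR_INZ. reflexivity.
      * rewrite (pairing_scal c (- Z.of_nat n)); auto; [|now apply trig_plus].
        f_equal. rewrite (pairing_plus c (- Z.of_nat n) (- Z.of_nat n)); auto.
        rewrite (pairing_trig_1 c rho Hc Hr). ring.
    + apply trig_scal, trig_plus; auto.
Qed.

(** Each step contributes [2 pi beta delta] and damps what was gained before by [(1 - beta^2)^2], so
    [K] steps lose at most the factor [(1 - beta^2)^(2 K)]. The bound [N] precedes [c] in the
    quantifiers: a radius can then be chosen close to [R0] in terms of [N]. *)
Lemma paley_test (S : nat -> Prop) (beta : R) (K : nat) :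
  (forall m, exists n, (m <= n)%nat /\ S n) -> 0 < beta < 1 ->
  exists N : nat, forall (c : nat -> C) (delta : R),
    summable c -> 0 < delta ->
    (forall n, S n -> (n <= N)%nat -> delta <= Cmod (c n)) ->
    exists psi, trig (- Z.of_nat N) psi /\ (forall t, Cmod (psi t) <= 1) /\
      2 * PI * beta * delta * INR K * (1 - beta ^ 2) ^ (2 * K) <= pairing c psi.
Proof.
  intros HS Hb. induction K as [|K [N IH]].
  - exists 0%nat. intros c delta Hc Hd Hcn. exists (fun _ => 0%C).
    split; [apply trig_const | split].
    + intros t. rewrite Cmod_0. lra.
    + unfold pairing. rewrite (RInt_ext _ (fun _ => 0)).
      * rewrite RInt_const. simpl. unfold scal; simpl; unfold mult; simpl. lra.
      * intros t _. rewrite Cmult_0_r. reflexivity.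
  - destruct (HS (2 * N + 1)%nat) as [n [Hn Sn]].
    exists n. intros c delta Hc Hd Hcn.
    destruct (IH c delta Hc Hd) as [psi [Tp [H1 Hpsi]]].
    { intros k Sk Hk. apply Hcn; auto. lia. }
    destruct (phase_exists (c n)) as [w [Hw Ew]].
    (* The phase of [b] is aligned with [c n], so that [Re (c n * conj b) = beta |c n|]. *)
    destruct (schur_step beta (RtoC beta * Cconj w) psi N n) as [psi' [Tp' [H1' Hpsi']]]; auto.
    { rewrite Cmod_mult, Cmod_R, Cmod_conj, Hw, Rabs_pos_eq; lra. }
    exists psi'. split; [|split]; auto. rewrite Hpsi' by exact Hc.
    replace (Re (c n * Cconj (beta * Cconj w))) with (beta * Cmod (c n)).
    2:{ rewrite Cmult_conj, Cconj_conj.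
        replace (c n * (Cconj beta * w))%C with (Cconj beta * (c n * w))%C by ring.
        rewrite Ew. unfold Cconj; simpl. ring. }
    assert (Hcn' := Hcn n Sn (le_n _)).
    set (q := 1 - beta ^ 2) in *.
    assert (Hq : 0 < q < 1) by (unfold q; nra).
    replace (2 * Datatypes.S K)%nat with (2 + 2 * K)%nat by lia.
    rewrite pow_add, S_INR.
    assert (Hqk : 0 < q ^ (2 * K) <= 1).
    { split; [apply pow_lt; lra|]. rewrite <- (pow1 (2 * K)). apply pow_incr; lra. }
    set (Y := q ^ (2 * K)) in *.
    assert (HPI := PI_RGT_0).
    assert (A1 : 2 * PI * beta * delta <= 2 * PI * (beta * Cmod (c n))).
    { assert (PI * beta * delta <= PI * beta * Cmod (c n)); [|lra].
      apply Rmult_le_compat_l; [|lra]. apply Rmult_le_pos; lra. }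
    assert (A0 : 0 < 2 * PI * beta * delta).
    { assert (0 < PI * beta * delta); [|lra].
      apply Rmult_lt_0_compat; [apply Rmult_lt_0_compat|]; lra. }
    set (X := 2 * PI * beta * delta) in *.
    apply Rle_trans with (q * (q * X + q * (X * INR K * Y))).
    + replace (q * (q * X + q * (X * INR K * Y))) with (q ^ 2 * (X + X * INR K * Y)) by ring.
      replace (X * (INR K + 1) * (q ^ 2 * Y)) with (q ^ 2 * (X * Y + X * INR K * Y)) by ring.
      apply Rmult_le_compat_l; [nra|]. nra.
    + apply Rmult_le_compat_l; [lra|]. apply Rplus_le_compat.
      * nra.
      * apply Rmult_le_compat_l; lra.
Qed.

(** * Coefficients of functions in H^1 *)

Lemma bernoulli_le (x : R) (n : nat) : 0 <= x <= 1 -> 1 - INR n * x <= (1 - x) ^ n.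
Proof.
  intros Hx. induction n as [|n IH].
  - simpl; lra.
  - rewrite S_INR. change ((1 - x) ^ S n) with ((1 - x) * (1 - x) ^ n).
    generalize (pos_INR n). intros Hn. assert (0 <= INR n * x * x) by (apply Rmult_le_pos; nra). nra.
Qed.

Lemma summable_disc (a : nat -> C) (R0 r : R) :
  CV_radius (fun k => Cmod (a k)) = Finite R0 -> 0 <= r < R0 ->
  summable (fun k => a k * RtoC (r ^ k))%C.
Proof.
  intros HR Hr. unfold summable.
  apply ex_series_ext with (fun k => Rabs (Cmod (a k) * r ^ k)).
  - intros k. now rewrite Cmod_mult, Cmod_R, Rabs_mult, (Rabs_pos_eq (Cmod _)) by apply Cmod_ge_0.
  - apply CV_disk_inside. rewrite HR. simpl. rewrite Rabs_pos_eq; lra.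
Qed.

Lemma M1_scale (a : nat -> C) (r : R) :
  2 * PI * M1 a r = RInt (fun t => Cmod (psum (fun k => a k * RtoC (r ^ k))%C (cis t))) 0 (2 * PI).
Proof.
  unfold M1. rewrite <- Rmult_assoc, Rinv_r, Rmult_1_l by (generalize PI_RGT_0; lra).
  apply RInt_ext; intros t _. now rewrite psum_scale.
Qed.

Lemma M1_ge_coef (a : nat -> C) (R0 r : R) (n : nat) :
  CV_radius (fun k => Cmod (a k)) = Finite R0 -> 0 < r < R0 ->
  Cmod (a n) * r ^ n <= M1 a r.
Proof.
  intros HR Hr.
  assert (Hs := summable_disc a R0 r HR ltac:(lra)).
  assert (H := Cmod_coef_le _ n Hs). rewrite <- M1_scale, Cmod_mult, Cmod_R, Rabs_pos_eq in H
    by (apply pow_le; lra).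
  assert (HPI := PI_RGT_0). apply Rmult_le_reg_l with (2 * PI); lra.
Qed.

Lemma at_left_between (l x : R) : l < x -> at_left x (fun r => l < r < x).
Proof.
  intros H. exists (mkposreal (x - l) ltac:(lra)). intros y Hy Hyx.
  unfold ball in Hy; simpl in Hy; unfold AbsRing_ball, abs, minus, plus, opp in Hy; simpl in Hy.
  apply Rabs_def2 in Hy. lra.
Qed.

Lemma filterlim_at_left_continuous (f : R -> R) (x : R) :
  continuous f x -> filterlim f (at_left x) (locally (f x)).
Proof. intros H. apply filterlim_filter_le_1 with (2 := H). apply filter_le_within. Qed.

Lemma continuous_pow (n : nat) (x : R) : continuous (fun r => r ^ n) x.
Proof. apply (ex_derive_continuous (fun r => r ^ n)). auto_derive; auto. Qed.

Lemma H1_ge_coef (a : nat -> C) (R0 L : R) (n : nat) :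
  0 < R0 -> CV_radius (fun k => Cmod (a k)) = Finite R0 -> M1_limit a R0 L ->
  Cmod (a n) * R0 ^ n <= L.
Proof.
  intros HR0 HR HL.
  apply (filterlim_le (F := at_left R0) (fun r => Cmod (a n) * r ^ n) (M1 a)
    (Finite (Cmod (a n) * R0 ^ n)) (Finite L)).
  - apply filter_imp with (2 := at_left_between 0 R0 HR0). intros r Hr. now apply M1_ge_coef with R0.
  - apply (filterlim_at_left_continuous (fun r => Cmod (a n) * r ^ n)).
    apply (continuous_scal_r (Cmod (a n)) (fun r => r ^ n)), continuous_pow.
  - exact HL.
Qed.

(* Paley's inequality, in the form: if infinitely many [|a n| R0^n] were at least
   [eps], a lacunary choice of [m^2] of them would force [M1] above a multiple of
   [m eps]. *)
Lemma H1_coef_to_0 (a : nat -> C) (R0 L eps : R) :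
  0 < R0 -> CV_radius (fun k => Cmod (a k)) = Finite R0 -> M1_limit a R0 L -> 0 < eps ->
  exists N, forall n, (N <= n)%nat -> Cmod (a n) * R0 ^ n < eps.
Proof.
  intros HR0 HR HL He. apply NNPP. intros Hno.
  assert (HL0 : 0 <= L).
  { apply Rle_trans with (2 := H1_ge_coef a R0 L 0 HR0 HR HL). simpl.
    generalize (Cmod_ge_0 (a 0%nat)); lra. }
  set (S := fun n => eps <= Cmod (a n) * R0 ^ n).
  assert (HS : forall m, exists n, (m <= n)%nat /\ S n).
  { intros m. apply NNPP. intros Hm. apply Hno. exists m. intros n Hn.
    apply Rnot_le_lt. intros H. apply Hm. exists n. auto. }
  (* The pairing will give [eps m / 4 < 2 (L + 1)], which this [m] violates. *)
  destruct (nfloor_ex (8 * (L + 1) / eps)) as [m0 Hm0].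
  { apply Rdiv_le_0_compat; lra. }
  set (m := Datatypes.S m0).
  assert (Hm : 8 * (L + 1) < eps * INR m).
  { unfold m; rewrite S_INR.
    replace (8 * (L + 1)) with (eps * (8 * (L + 1) / eps)) by (field; lra).
    apply Rmult_lt_compat_l; lra. }
  assert (Hm1 : 1 <= INR m) by (unfold m; rewrite S_INR; generalize (pos_INR m0); lra).
  (* For [K = m^2] steps the gain is proportional to [K beta = m / 2], while [2 K beta^2 = 1 / 2]
     keeps the damping at least [1 / 2] by Bernoulli's inequality. *)
  set (beta := / (2 * INR m)).
  assert (Hb : 0 < beta < 1).
  { unfold beta. split; [apply Rinv_0_lt_compat; lra|].
    rewrite <- Rinv_1. apply Rinv_lt_contravar; lra. }
  destruct (paley_test S beta (m * m) HS Hb) as [N HN].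
  (* Since [N] is already fixed, [r] can be so close to [R0] that passing from [R0^n] to [r^n] costs
     at most a factor 2 for all [n <= N]. *)
  assert (Hr : at_left R0 (fun r => 0 < r < R0 /\ M1 a r < L + 1 /\ / 2 < (r / R0) ^ N)).
  { apply filter_and; [now apply at_left_between | apply filter_and].
    - apply (HL (fun y => y < L + 1)). exists (mkposreal 1 Rlt_0_1). intros y Hy.
      unfold ball in Hy; simpl in Hy; unfold AbsRing_ball, abs, minus, plus, opp in Hy; simpl in Hy.
      apply Rabs_def2 in Hy. lra.
    - assert (C : continuous (fun r => (r / R0) ^ N) R0).
      { apply (ex_derive_continuous (fun r => (r / R0) ^ N)). auto_derive; auto. }
      apply (filterlim_at_left_continuous _ _ C (fun y => / 2 < y)).
      unfold Rdiv. rewrite Rinv_r, pow1 by lra.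
      exists (mkposreal (/ 2) ltac:(lra)). intros y Hy.
      unfold ball in Hy; simpl in Hy; unfold AbsRing_ball, abs, minus, plus, opp in Hy; simpl in Hy.
      apply Rabs_def2 in Hy. lra. }
  destruct (filter_ex _ Hr) as [r [Hr0 [HM Hp]]].
  assert (Hs := summable_disc a R0 r HR ltac:(lra)).
  destruct (HN _ (eps / 2) Hs ltac:(lra)) as [psi [Tpsi [H1 Hpsi]]].
  { intros n Sn HnN. unfold S in Sn. rewrite Cmod_mult, Cmod_R, Rabs_pos_eq by (apply pow_le; lra).
    assert (Hq : 0 <= r / R0 <= 1).
    { split; [apply Rdiv_le_0_compat; lra|]. apply Rmult_le_reg_r with R0; [lra|].
      unfold Rdiv. rewrite Rmult_assoc, Rinv_l; lra. }
    replace (r ^ n) with (R0 ^ n * (r / R0) ^ n).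
    2:{ rewrite <- Rpow_mult_distr. f_equal. field; lra. }
    assert (Hpn : / 2 < (r / R0) ^ n).
    { apply Rlt_le_trans with (1 := Hp). replace N with (n + (N - n))%nat by lia.
      rewrite pow_add.
      assert (0 <= (r / R0) ^ (N - n) <= 1).
      { split; [apply pow_le; lra|]. rewrite <- (pow1 (N - n)). apply pow_incr; lra. }
      assert (0 <= (r / R0) ^ n) by (apply pow_le; lra). nra. }
    nra. }
  assert (HU := pairing_le _ _ psi Hs Tpsi H1). rewrite <- M1_scale in HU.
  assert (HB : / 2 <= (1 - beta ^ 2) ^ (2 * (m * m))).
  { apply Rle_trans with (2 := bernoulli_le (beta ^ 2) (2 * (m * m)) ltac:(nra)).
    rewrite !mult_INR. unfold beta. simpl (INR 2).
    right. field. lra. }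
  assert (HPI := PI_RGT_0).
  set (Y := (1 - beta ^ 2) ^ (2 * (m * m))) in *.
  assert (E : 2 * PI * beta * (eps / 2) * INR (m * m) * Y = PI * (eps * INR m * Y / 2)).
  { rewrite mult_INR. unfold beta. field. lra. }
  rewrite E in Hpsi.
  assert (F : PI * (eps * INR m * Y / 2) < PI * (2 * (L + 1))).
  { apply Rle_lt_trans with (1 := Hpsi). apply Rle_lt_trans with (1 := HU).
    rewrite (Rmult_comm 2 PI), Rmult_assoc. apply Rmult_lt_compat_l; lra. }
  apply Rmult_lt_reg_l in F; [|lra].
  assert (eps * INR m * / 2 <= eps * INR m * Y).
  { apply Rmult_le_compat_l; [|lra]. apply Rmult_le_pos; lra. }
  lra.
Qed.

(** * The averaged Poisson kernel *)

(* Truncation of [P - x dP/dx], where [P] is the Poisson kernel in the variable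
   [x = - ln rho]; unlike [P''], this kernel is positive. *)
Fixpoint ker (x : R) (M : nat) (s : R) : R :=
  match M with
  | O => 1
  | S M' => ker x M' s + 2 * (1 + INR M * x) * exp (- (INR M * x)) * cos (INR M * s)
  end.

(** With [r = e^{-x}], [P = (1 - r^2) / ker_den] and [P - x dP/dx = ker_num / ker_den^2]. *)
Definition ker_num (x s : R) : R :=
  let r := exp (- x) in
  (1 - r ^ 2) * (1 - 2 * r * cos s + r ^ 2) + 2 * x * ((r + r ^ 3) * cos s - 2 * r ^ 2).

Definition ker_den (x s : R) : R :=
  let r := exp (- x) in 1 - 2 * r * cos s + r ^ 2.

Lemma exp_lt_1 (x : R) : 0 < x -> 0 < exp (- x) < 1.
Proof.
  intros Hx. split; [apply exp_pos|]. rewrite <- exp_0. apply exp_increasing; lra.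
Qed.

Lemma pow_exp (x : R) (n : nat) : exp (- x) ^ n = exp (- (INR n * x)).
Proof.
  induction n as [|n IH].
  - simpl. now rewrite Rmult_0_l, Ropp_0, exp_0.
  - rewrite S_INR. change (exp (- x) ^ S n) with (exp (- x) * exp (- x) ^ n).
    rewrite IH, <- exp_plus. f_equal; ring.
Qed.

(** The holomorphic half of the kernel, [sum (1 + m x) z^m], to be taken at [z = e^{-x + is}]. Its
    full sum is [(1 - z + x z) / (1 - z)^2]. *)
Fixpoint ker_hol (x : R) (z : C) (M : nat) : C :=
  match M with
  | O => 1
  | S M' => ker_hol x z M' + RtoC (1 + INR M * x) * Cpow z M
  end%C.

Lemma ker_hol_closed (x : R) (z : C) (M : nat) :
  ((1 - z) * (1 - z) * ker_hol x z M = 1 - z + x * z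
     - Cpow z (S M) * (RtoC (1 + INR (S M) * x) - RtoC (1 + INR M * x) * z))%C.
Proof.
  induction M as [|M IH].
  - simpl. rewrite !Rmult_1_l, Rmult_0_l, Rplus_0_r, RtoC_plus. ring.
  - cbn [ker_hol]. rewrite Cmult_plus_distr_l, IH, !(Cpow_S z).
    rewrite !S_INR, !RtoC_plus, !RtoC_mult, !RtoC_plus. ring.
Qed.

Lemma ker_Re (x : R) (M : nat) (s : R) :
  ker x M s = 2 * Re (ker_hol x (RtoC (exp (- x)) * cis s) M) - 1.
Proof.
  induction M as [|M IH].
  - simpl. ring.
  - cbn [ker ker_hol]. rewrite IH, Cpow_mult_l, <- RtoC_pow, Cpow_cis, pow_exp.
    set (h := ker_hol _ _ _). set (A := 1 + INR (S M) * x). set (E := exp (- (INR (S M) * x))).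
    destruct h as [h1 h2]. unfold cis. simpl. ring.
Qed.

Lemma ker_den_ge (x s : R) : 0 < x ->
  (1 - exp (- x)) ^ 2 <= ker_den x s /\ 2 * exp (- x) * (1 - cos s) <= ker_den x s.
Proof.
  intros Hx. unfold ker_den. destruct (exp_lt_1 x Hx) as [H0 H1]. set (r := exp (- x)) in *.
  generalize (COS_bound s). intros Hc. split; nra.
Qed.

(** The identity [2 Re (num / W^2) - 1 = ker_num / ker_den^2], cleared of the denominator
    [|W|^4 = ker_den^2]. *)
Lemma ker_hol_Re_limit (x s : R) (W num : C) : 0 < x ->
  W = (1 - RtoC (exp (- x)) * cis s)%C ->
  num = (1 - RtoC (exp (- x)) * cis s + x * (RtoC (exp (- x)) * cis s))%C ->
  2 * Re (num * (Cconj W * Cconj W)) - ker_den x s ^ 2 = ker_num x s.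
Proof.
  intros Hx -> ->. unfold ker_den, ker_num, cis. set (r := exp (- x)).
  generalize (sin2_cos2 s). unfold Rsqr. set (c := cos s). set (t := sin s). intros Hsc.
  simpl.
  assert (Ht : t * t = 1 - c * c) by lra.
  ring_simplify.
  replace (t ^ 2) with (1 - c * c) by (simpl; lra).
  ring.
Qed.

(** The error is [2 |Re (E (conj W)^2)| / ker_den^2], where [E] is the remainder of the closed form.
    It is uniform in [s] because [ker_den >= (1 - r)^2]; [G / (M + 1)] is the resulting bound. *)
Lemma ker_limit (x eps : R) : 0 < x -> 0 < eps ->
  exists M0, forall M s, (M0 <= M)%nat ->
    Rabs (ker x M s - ker_num x s / ker_den x s ^ 2) <= eps.
Proof.
  intros Hx He. destruct (exp_lt_1 x Hx) as [H0 H1].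
  set (r := exp (- x)) in *.
  set (G := 16 / (x * (1 - r) ^ 2)).
  assert (HG : 0 < G). { apply Rdiv_lt_0_compat; [lra|]. apply Rmult_lt_0_compat; [lra|]. apply pow_lt; lra. }
  destruct (nfloor_ex (G / eps)) as [M0 HM0]. { apply Rlt_le, Rdiv_lt_0_compat; lra. }
  exists M0. intros M s HM.
  set (z := (RtoC r * cis s)%C). set (W := (1 - z)%C).
  set (num := (1 - z + x * z)%C).
  assert (Hd := ker_den_ge x s Hx). destruct Hd as [Hd _]. fold r in Hd.
  assert (Hr2 : 0 < (1 - r) ^ 2) by (apply pow_lt; lra).
  assert (EW : (W * Cconj W)%C = RtoC (ker_den x s)).
  { rewrite <- Cmod2_conj, Cmod2_alt. f_equal.
    unfold W, z, ker_den, cis. fold r. simpl.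
    generalize (sin2_cos2 s). unfold Rsqr. intros Hsc.
    replace (1 - 2 * r * cos s + r * (r * 1)) with
      (1 - 2 * r * cos s + r * r * (sin s * sin s + cos s * cos s)) by (rewrite Hsc; ring).
    ring. }
  set (d := ker_den x s) in *.
  set (E := (Cpow z (S M) * (RtoC (1 + INR (S M) * x) - RtoC (1 + INR M * x) * z))%C).
  assert (EK : ker x M s - ker_num x s / d ^ 2 = - 2 * Re (E * (Cconj W * Cconj W)) / d ^ 2).
  { assert (Q : (RtoC (d * d) * ker_hol x z M = (num - E) * (Cconj W * Cconj W))%C).
    { unfold num, E. rewrite <- (ker_hol_closed x z M). fold W.
      rewrite RtoC_mult, <- EW. ring. }
    apply (f_equal Re) in Q.
    assert (Q1 : Re (RtoC (d * d) * ker_hol x z M) = d * d * Re (ker_hol x z M)).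
    { rewrite re_mult. simpl. ring. }
    assert (Q2 : Re ((num - E) * (Cconj W * Cconj W)) =
       Re (num * (Cconj W * Cconj W)) - Re (E * (Cconj W * Cconj W))).
    { rewrite !re_mult. destruct num, E. simpl. ring. }
    rewrite Q1, Q2 in Q.
    assert (Q3 := ker_hol_Re_limit x s W num Hx eq_refl eq_refl). fold d in Q3.
    rewrite ker_Re. fold r. fold z. rewrite <- Q3.
    assert (Q4 : Re (ker_hol x z M) =
       (Re (num * (Cconj W * Cconj W)) - Re (E * (Cconj W * Cconj W))) / (d * d)).
    { rewrite <- Q. field. lra. }
    rewrite Q4. field. lra. }
  rewrite EK.
  assert (Hz : Cmod z = r).
  { unfold z. rewrite Cmod_mult, Cmod_R, Cmod_cis, Rabs_pos_eq; lra. }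
  set (y := INR (S M) * x).
  assert (Hy : 0 < y). { apply Rmult_lt_0_compat; [apply lt_0_INR; lia | lra]. }
  assert (HE : Cmod E <= 8 / y).
  { unfold E. rewrite Cmod_mult, Cmod_pow, Hz. unfold r. rewrite pow_exp. fold y.
    apply Rle_trans with (exp (- y) * (2 * (1 + y))).
    - apply Rmult_le_compat_l; [left; apply exp_pos|].
      apply Rle_trans with (1 := Cmod_triangle _ _).
      rewrite Cmod_opp, Cmod_mult, Hz, !Cmod_R.
      assert (0 <= INR M * x) by (apply Rmult_le_pos; [apply pos_INR|lra]).
      assert (INR M * x <= y) by (unfold y; rewrite S_INR; lra).
      rewrite !Rabs_pos_eq by lra. nra.
    (* [e^y >= (1 + y/2)^2], and [2 y (1 + y) <= 8 (1 + y/2)^2]; this is the origin of the 8. *)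
    - assert (P : (1 + y / 2) * (1 + y / 2) * exp (- y) <= 1).
      { assert (P1 := exp_ineq1_le (y / 2)).
        assert (P2 : exp (y / 2) * exp (y / 2) * exp (- y) = 1).
        { rewrite <- !exp_plus. replace (y / 2 + y / 2 + - y) with 0 by field. apply exp_0. }
        rewrite <- P2. apply Rmult_le_compat_r; [left; apply exp_pos|]. nra. }
      generalize (exp_pos (- y)). intros P3.
      apply Rmult_le_reg_r with y; [lra|]. replace (8 / y * y) with 8 by (field; lra). nra. }
  assert (HEW : Rabs (Re (E * (Cconj W * Cconj W))) <= 8 / y * d).
  { apply Rle_trans with (1 := Re_Cmult_le _ _). rewrite Cmod_mult, Cmod_conj.
    replace (Cmod W * Cmod W) with d.
    - apply Rmult_le_compat_r; lra.
    - rewrite <- (Rabs_pos_eq d) by lra. rewrite <- Cmod_R, <- EW, Cmod_mult, Cmod_conj. reflexivity. }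
  unfold Rdiv. rewrite !Rabs_mult, (Rabs_left (-2)) by lra.
  rewrite (Rabs_pos_eq (/ d ^ 2)) by (left; apply Rinv_0_lt_compat, pow_lt; lra).
  apply Rle_trans with (2 * (8 / y * d) * / d ^ 2).
  { apply Rmult_le_compat_r; [left; apply Rinv_0_lt_compat, pow_lt; lra|]. lra. }
  replace (2 * (8 / y * d) * / d ^ 2) with (16 / y * / d) by (field; lra).
  apply Rle_trans with (16 / y * / (1 - r) ^ 2).
  { apply Rmult_le_compat_l; [left; apply Rdiv_lt_0_compat; lra|].
    apply Rinv_le_contravar; lra. }
  replace (16 / y * / (1 - r) ^ 2) with (G / INR (S M)).
  2:{ unfold G, y. field. split; [|split]; try lra. apply not_0_INR; lia. }
  apply Rmult_le_reg_r with (INR (S M)); [apply lt_0_INR; lia|].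
  unfold Rdiv. rewrite Rmult_assoc, Rinv_l, Rmult_1_r by (apply not_0_INR; lia).
  replace G with (eps * (G / eps)) by (field; lra).
  apply Rmult_le_compat_l; [lra|].
  rewrite S_INR. apply le_INR in HM. lra.
Qed.

(** * Positivity and size of the limit kernel *)

Lemma is_derive_le_MVT (f df : R -> R) (a b m : R) :
  a <= b -> (forall t, a <= t <= b -> is_derive f t (df t)) ->
  (forall t, a <= t <= b -> m <= df t) -> m * (b - a) <= f b - f a.
Proof.
  intros Hab Hd Hm.
  destruct (MVT_gen f a b df) as [c [Hc E]].
  - rewrite Rmin_left, Rmax_right by lra. intros t Ht. apply Hd; lra.
  - rewrite Rmin_left, Rmax_right by lra. intros t Ht.
    apply continuity_pt_filterlim, (ex_derive_continuous f). exists (df t). apply Hd; lra.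
  - rewrite Rmin_left, Rmax_right in Hc by lra. rewrite E.
    apply Rmult_le_compat_r; [lra|]. auto.
Qed.

(** The derivative is [(e^{t/2} - e^{-t/2})^2], which lies between 0 and [4 t^2] on [[0, 1]]. *)
Lemma sinh_bounds (x : R) : 0 <= x <= 1 ->
  0 <= exp x - exp (- x) - 2 * x <= 4 * x ^ 3.
Proof.
  intros Hx.
  set (f := fun t => exp t - exp (- t) - 2 * t).
  assert (Hd : forall t, is_derive f t (exp t + exp (- t) - 2)).
  { intros t. unfold f. auto_derive; auto. ring. }
  assert (E : forall t, exp t + exp (- t) - 2 = (exp (t / 2) - exp (- (t / 2))) ^ 2).
  { intros t. replace (exp t) with (exp (t / 2) * exp (t / 2)) by (rewrite <- exp_plus; f_equal; field).
    replace (exp (- t)) with (exp (- (t / 2)) * exp (- (t / 2))) by (rewrite <- exp_plus; f_equal; field).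
    assert (exp (t / 2) * exp (- (t / 2)) = 1) by (rewrite <- exp_plus, <- exp_0; f_equal; ring).
    nra. }
  assert (f0 : f 0 = 0) by (unfold f; rewrite Ropp_0; ring).
  assert (H1 : 0 * (x - 0) <= f x - f 0).
  { apply (is_derive_le_MVT f (fun t => exp t + exp (- t) - 2)); [lra | intros; apply Hd |].
    intros t _. rewrite E. apply pow2_ge_0. }
  assert (H2 : - (4 * x ^ 2) * (x - 0) <= - f x - - f 0).
  { apply (is_derive_le_MVT (fun t => - f t) (fun t => - (exp t + exp (- t) - 2))); [lra | |].
    - intros t _. apply (is_derive_opp f). apply Hd.
    - intros t Ht. rewrite E. apply Ropp_le_contravar.
      assert (A1 : exp (t / 2) * exp (- (t / 2)) = 1)
        by (rewrite <- exp_plus, <- exp_0; f_equal; ring).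
      assert (A2 := exp_ineq1_le (- (t / 2))).
      assert (A3 := exp_ineq1_le (t / 2)).
      assert (A4 := exp_pos (- (t / 2))).
      assert (A5 : exp (t / 2) * (1 + - (t / 2)) <= 1)
        by (rewrite <- A1; apply Rmult_le_compat_l; lra).
      set (e := exp (t / 2)) in *. set (e' := exp (- (t / 2))) in *.
      assert (A6 : e <= 2) by nra.
      assert (A7 : e - 1 <= t) by nra.
      assert (A9 : e' <= 1) by nra.
      assert (A8 : 0 <= e - e' <= 2 * t) by lra.
      nra. }
  unfold f in *. simpl in *. split; nra.
Qed.

(** The numerator is affine in [cos s], hence a convex combination of its values at [cos s = 1] and
    [cos s = -1], namely [psi] and [(1 + r)^2 phi]. Since [phi = 2 e^{-x} (sinh x - x)], both
    positivity and the cubic order of the second value come from [sinh]. *)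
Lemma ker_num_bounds (x s : R) : 0 < x <= 1 -> 0 <= ker_num x s <= 16 * x ^ 3.
Proof.
  intros Hx. assert (Hs := sinh_bounds x ltac:(lra)).
  destruct (exp_lt_1 x ltac:(lra)) as [H0 H1].
  assert (E : exp x * exp (- x) = 1) by (rewrite <- exp_plus, <- exp_0; f_equal; ring).
  assert (Hr := exp_ineq1_le (- x)).
  unfold ker_num. set (r := exp (- x)) in *. set (c := cos s).
  assert (Hc : -1 <= c <= 1) by apply COS_bound.
  set (phi := 1 - r ^ 2 - 2 * x * r).
  assert (Hphi : 0 <= phi <= 4 * x ^ 3).
  { replace phi with (r * (exp x - r - 2 * x)) by (unfold phi; rewrite <- E; ring).
    split; [apply Rmult_le_pos; lra|]. nra. }
  set (psi := (1 - r) ^ 2 * (1 - r ^ 2 + 2 * x * r)).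
  assert (Hpsi : 0 <= psi <= 4 * x ^ 3).
  { unfold psi.
    assert (0 <= (1 - r) ^ 2 <= x ^ 2) by (simpl; nra).
    assert (0 <= 1 - r ^ 2 + 2 * x * r <= 4 * x) by (simpl; nra).
    split; [apply Rmult_le_pos; lra|].
    replace (4 * x ^ 3) with (x ^ 2 * (4 * x)) by ring. apply Rmult_le_compat; lra. }
  replace ((1 - r ^ 2) * (1 - 2 * r * c + r ^ 2) + 2 * x * ((r + r ^ 3) * c - 2 * r ^ 2))
    with ((1 + c) / 2 * psi + (1 - c) / 2 * ((1 + r) ^ 2 * phi))
    by (unfold psi, phi; field).
  assert (Hphi2 : 0 <= (1 + r) ^ 2 * phi <= 16 * x ^ 3).
  { split; [apply Rmult_le_pos; [apply pow2_ge_0|lra]|].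
    replace (16 * x ^ 3) with (4 * (4 * x ^ 3)) by ring.
    apply Rmult_le_compat; [apply pow2_ge_0|lra|nra|lra]. }
  set (A := (1 + r) ^ 2 * phi) in *. set (X := x ^ 3) in *.
  split; nra.
Qed.

(** * Integrals of the truncated kernel against cosines *)

Ltac eq_R := match goal with |- @eq _ ?a ?b => change (@eq R a b) end.

Lemma RInt_cos_Z (k : Z) : k <> 0%Z -> RInt (fun s => cos (IZR k * s)) 0 PI = 0.
Proof.
  intros Hk. assert (Hk' : IZR k <> 0) by now apply not_0_IZR.
  assert (H : is_RInt (fun s => cos (IZR k * s)) 0 PI
    (minus (sin (IZR k * PI) / IZR k) (sin (IZR k * 0) / IZR k))).
  { apply (is_RInt_derive (fun s => sin (IZR k * s) / IZR k) (fun s => cos (IZR k * s))).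
    - intros s _. auto_derive; auto. eq_R; field; auto.
    - intros s _. apply (ex_derive_continuous (fun s => cos (IZR k * s))). auto_derive; auto. }
  rewrite (is_RInt_unique _ _ _ _ H).
  rewrite (sin_eq_0_1 (IZR k * PI)) by now exists k.
  rewrite Rmult_0_r, sin_0. unfold minus, plus, opp; simpl. eq_R; field; auto.
Qed.

Lemma continuous_cos_mult (k s : R) : continuous (fun s => cos (k * s)) s.
Proof. apply (ex_derive_continuous (fun s => cos (k * s))). auto_derive; auto. Qed.

Lemma continuous_Rmult (f g : R -> R) (s : R) :
  continuous f s -> continuous g s -> continuous (fun s => f s * g s) s.
Proof. apply (continuous_mult (K := R_AbsRing)). Qed.

Lemma RInt_cos_cos (m n : nat) : (1 <= n)%nat ->
  RInt (fun s => cos (INR m * s) * cos (INR n * s)) 0 PI = if Nat.eq_dec m n then PI / 2 else 0.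
Proof.
  intros Hn.
  assert (E : RInt (fun s => cos (INR m * s) * cos (INR n * s)) 0 PI =
    / 2 * (RInt (fun s => cos (IZR (Z.of_nat m + Z.of_nat n) * s)) 0 PI
         + RInt (fun s => cos (IZR (Z.of_nat m - Z.of_nat n) * s)) 0 PI)).
  { rewrite <- (RInt_plus (V := R_CompleteNormedModule)).
    2, 3 : apply ex_RInt_cont; intros; apply continuous_cos_mult.
    rewrite <- (RInt_scal (V := R_CompleteNormedModule)).
    - apply RInt_ext. intros s _. unfold scal, plus; simpl; unfold mult; simpl.
      rewrite plus_IZR, minus_IZR, <- !INR_IZR_INZ, Rmult_plus_distr_r.
      unfold Rminus. rewrite Rmult_plus_distr_r, <- Ropp_mult_distr_l.
      rewrite !cos_plus, cos_neg, sin_neg. eq_R; field.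
    - apply ex_RInt_cont; intros t.
      apply (continuous_plus (fun s => cos (IZR (Z.of_nat m + Z.of_nat n) * s))
        (fun s => cos (IZR (Z.of_nat m - Z.of_nat n) * s))); apply continuous_cos_mult. }
  rewrite E, RInt_cos_Z by lia. destruct (Nat.eq_dec m n) as [->|H].
  - rewrite Z.sub_diag. rewrite (RInt_ext _ (fun _ => 1)).
    + rewrite RInt_const. unfold scal; simpl; unfold mult; simpl; eq_R; field.
    + intros s _. now rewrite Rmult_0_l, cos_0.
  - rewrite RInt_cos_Z by lia. eq_R; ring.
Qed.

Lemma continuous_ker (x : R) (M : nat) (s : R) : continuous (ker x M) s.
Proof.
  induction M as [|M IH].
  - apply continuous_const.
  - apply (continuous_plus (ker x M)
      (fun s => 2 * (1 + INR (S M) * x) * exp (- (INR (S M) * x)) * cos (INR (S M) * s))); auto.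
    apply continuous_Rmult; [apply continuous_const | apply continuous_cos_mult].
Qed.

Lemma RInt_ker_step (x : R) (M : nat) (g : R -> R) :
  (forall s, continuous g s) ->
  RInt (fun s => ker x (S M) s * g s) 0 PI = RInt (fun s => ker x M s * g s) 0 PI
   + 2 * (1 + INR (S M) * x) * exp (- (INR (S M) * x)) * RInt (fun s => cos (INR (S M) * s) * g s) 0 PI.
Proof.
  intros Hg. set (A := 2 * (1 + INR (S M) * x) * exp (- (INR (S M) * x))).
  assert (H : ex_RInt (fun s => cos (INR (S M) * s) * g s) 0 PI).
  { apply ex_RInt_cont; intros. apply continuous_Rmult; [apply continuous_cos_mult | auto]. }
  rewrite <- (RInt_scal (V := R_CompleteNormedModule)) by exact H.
  rewrite <- (RInt_plus (V := R_CompleteNormedModule)).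
  - apply RInt_ext. intros s _. unfold scal, plus; simpl; unfold mult; simpl.
    unfold A. simpl. eq_R; ring.
  - apply ex_RInt_cont; intros. apply continuous_Rmult; [apply continuous_ker | auto].
  - now apply (ex_RInt_scal (V := R_NormedModule)).
Qed.

Lemma RInt_ker (x : R) (M : nat) : RInt (fun s => ker x M s * 1) 0 PI = PI.
Proof.
  induction M as [|M IH].
  - simpl. rewrite RInt_const. unfold scal; simpl; unfold mult; simpl; eq_R; ring.
  - rewrite RInt_ker_step, IH by (intros; apply continuous_const).
    rewrite (RInt_ext _ (fun s => cos (IZR (Z.of_nat (S M)) * s))).
    + rewrite RInt_cos_Z by lia. eq_R; ring.
    + intros s _. rewrite <- INR_IZR_INZ. eq_R; ring.
Qed.

Lemma RInt_ker_cos (x : R) (M n : nat) : (1 <= n)%nat ->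
  RInt (fun s => ker x M s * cos (INR n * s)) 0 PI =
  if le_dec n M then PI * ((1 + INR n * x) * exp (- (INR n * x))) else 0.
Proof.
  intros Hn. induction M as [|M IH].
  - destruct (le_dec n 0); [lia|].
    rewrite (RInt_ext _ (fun s => cos (IZR (Z.of_nat n) * s))).
    + apply RInt_cos_Z; lia.
    + intros s _. rewrite <- INR_IZR_INZ. simpl. eq_R; ring.
  - rewrite RInt_ker_step, IH, RInt_cos_cos by (auto; intros; apply continuous_cos_mult).
    destruct (Nat.eq_dec (S M) n) as [<-|H].
    + destruct (le_dec (S M) M), (le_dec (S M) (S M)); try lia. eq_R; field.
    + destruct (le_dec n M), (le_dec n (S M)); try lia; eq_R; ring.
Qed.

(** The index [n] stands for the frequency [n + 1]: the constant term is treated apart, since it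
    cannot be divided by the squared frequency. *)
Definition freq (n : nat) : R := INR (S n).

Lemma freq_ge_1 (n : nat) : 1 <= freq n.
Proof. unfold freq. rewrite S_INR. generalize (pos_INR n); lra. Qed.

(** For [q n = Re (c_{n+1} e^{i(n+1)t})], the [n]-th term of [phi(t+s) + phi(t-s) - 2 phi(t)]. The
    Abel means at [t] have the same coefficients [q]. *)
Definition second_diff (q : nat -> R) (n : nat) (s : R) : R :=
  2 * q n * (1 - cos (freq n * s)) / freq n ^ 2.

(** A partial sum of [int_0^x y u(y) dy], where [u(y) = sum q_n e^{-(n+1)y}] is the Abel mean. *)
Definition riemann_mean (q : nat -> R) (N : nat) (x : R) : R :=
  sum_n (fun n => q n * (1 - (1 + freq n * x) * exp (- (freq n * x))) / freq n ^ 2) N.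

Lemma continuous_second_diff (q : nat -> R) (n : nat) (s : R) : continuous (second_diff q n) s.
Proof.
  apply (ex_derive_continuous (second_diff q n)). unfold second_diff. auto_derive; auto.
Qed.

(** For [N < M] the kernel contains every frequency up to [N + 1], so the identity is exact for
    finite sums and involves no interchange of limits. *)
Lemma RInt_ker_second_diff (q : nat -> R) (x : R) (M N : nat) : (N < M)%nat ->
  RInt (fun s => ker x M s * sum_n (fun n => second_diff q n s) N) 0 PI =
  2 * PI * riemann_mean q N x.
Proof.
  intros HN. unfold riemann_mean.
  rewrite (RInt_ext _ (fun s => sum_n (fun n => ker x M s * second_diff q n s) N)).
  2:{ intros s _. symmetry. apply (sum_n_mult_l (K := R_Ring)). }
  rewrite (RInt_sum_n (fun n s => ker x M s * second_diff q n s)).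
  2:{ intros; apply continuous_Rmult; [apply continuous_ker | apply continuous_second_diff]. }
  rewrite <- (sum_n_mult_l (K := R_Ring)). apply sum_n_ext_loc. intros n Hn.
  assert (Hf := freq_ge_1 n).
  transitivity (2 * q n / freq n ^ 2 *
    (RInt (fun s => ker x M s * 1) 0 PI - RInt (fun s => ker x M s * cos (INR (S n) * s)) 0 PI)).
  - assert (X1 : ex_RInt (fun s => ker x M s * 1) 0 PI).
    { apply ex_RInt_cont; intros; apply continuous_Rmult; [apply continuous_ker | apply continuous_const]. }
    assert (X2 : ex_RInt (fun s => ker x M s * cos (INR (S n) * s)) 0 PI).
    { apply ex_RInt_cont; intros; apply continuous_Rmult; [apply continuous_ker | apply continuous_cos_mult]. }
    rewrite <- (RInt_minus (V := R_CompleteNormedModule)) by assumption.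
    rewrite <- (RInt_scal (V := R_CompleteNormedModule))
      by now apply (ex_RInt_minus (V := R_NormedModule)).
    apply RInt_ext. intros s _. unfold second_diff, freq, scal, minus, plus, opp; cbn -[INR].
    unfold mult; cbn -[INR]; fold (freq n). eq_R; field. lra.
  - rewrite RInt_ker, RInt_ker_cos by lia. destruct (le_dec (S n) M); [|lia].
    fold (freq n). unfold mult; simpl; eq_R; field. lra.
Qed.

Lemma freq_sq_series : ex_series (fun n => / freq n ^ 2).
Proof.
  apply (ex_series_dom _ (fun n => 2 * (/ freq n - / freq (S n)))).
  - intros n. assert (H := freq_ge_1 n).
    assert (E : freq (S n) = freq n + 1) by (unfold freq; now rewrite (S_INR (S n))).
    rewrite E, Rabs_pos_eq by (left; apply Rinv_0_lt_compat, pow_lt; lra).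
    replace (2 * (/ freq n - / (freq n + 1))) with (2 * / (freq n * (freq n + 1))) by (field; lra).
    replace (2 * / (freq n * (freq n + 1))) with (/ (freq n * (freq n + 1) / 2)) by (field; lra).
    apply Rinv_le_contravar; nra.
  - apply (ex_series_scal_l (K := R_AbsRing) (V := R_NormedModule) 2).
    exists 1. change (is_lim_seq (sum_n (fun n => / freq n - / freq (S n))) 1).
    apply (is_lim_seq_ext (fun n => 1 - / freq (S n))).
    + intros n. induction n as [|n IH].
      * rewrite sum_O. unfold freq; simpl. eq_R; field.
      * rewrite sum_Sn, <- IH. unfold plus; simpl. eq_R; ring.
    + replace (Finite 1) with (Finite (1 - 0)) by (f_equal; ring).
      apply is_lim_seq_minus'; [apply is_lim_seq_const|].
      apply is_lim_seq_ext with (fun n => / INR (n + 2)).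
      { intros n. unfold freq. do 2 f_equal. lia. }
      apply -> (is_lim_seq_incr_n (fun n => / INR n) 2 0).
      apply (is_lim_seq_inv _ p_infty); [apply is_lim_seq_INR | discriminate].
Qed.

(** * Abel limits and second differences *)

Section Riemann.
Variables (q : nat -> R) (b : R).
Hypothesis Hq : forall n, Rabs (q n) <= b.

Let Hb : 0 <= b.
Proof. apply Rle_trans with (2 := Hq 0). apply Rabs_pos. Qed.

Lemma second_diff_le (n : nat) (s : R) : Rabs (second_diff q n s) <= 4 * b * / freq n ^ 2.
Proof.
  unfold second_diff, Rdiv. assert (H := freq_ge_1 n).
  assert (Hi : 0 < / freq n ^ 2) by (apply Rinv_0_lt_compat, pow_lt; lra).
  rewrite Rabs_mult, (Rabs_pos_eq (/ _)) by lra. apply Rmult_le_compat_r; [lra|].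
  rewrite !Rabs_mult, (Rabs_pos_eq 2) by lra.
  generalize (COS_bound (freq n * s)). intros Hc. rewrite (Rabs_pos_eq (1 - _)) by lra.
  generalize (Hq n) (Rabs_pos (q n)). intros. nra.
Qed.

Lemma ex_series_second_diff_bound : ex_series (fun n => 4 * b * / freq n ^ 2).
Proof. apply (ex_series_scal_l (K := R_AbsRing) (V := R_NormedModule) (4 * b)), freq_sq_series. Qed.

Lemma second_diff_sum_le : exists P, 0 <= P /\
  forall N s, Rabs (sum_n (fun n => second_diff q n s) N) <= P.
Proof.
  set (G := fun n => 4 * b * / freq n ^ 2).
  assert (HG : ex_series G) by apply ex_series_second_diff_bound.
  assert (G0 : forall n, 0 <= G n).
  { intros n. apply Rle_trans with (2 := second_diff_le n 0). apply Rabs_pos. }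
  exists (Series G).
  assert (Hs : forall N, sum_n G N <= Series G).
  { intros N. apply (is_lim_seq_incr_compare (sum_n G)).
    - exact (Series_correct _ HG).
    - intros n. rewrite sum_Sn. unfold plus; simpl. generalize (G0 (S n)); lra. }
  split.
  - apply Rle_trans with (2 := Hs 0%nat). rewrite sum_O. apply G0.
  - intros N s. apply Rle_trans with (2 := Hs N).
    induction N as [|N IH].
    + rewrite !sum_O. apply second_diff_le.
    + rewrite !sum_Sn. apply Rle_trans with (1 := Rabs_triang _ _).
      apply Rplus_le_compat; [apply IH | apply second_diff_le].
Qed.

(* If the Riemann function is locally maximal at the point, positivity of the
   kernel bounds the averaged Abel means by the tail of the kernel, which is
   of order [x^3]. *)
Lemma riemann_mean_upper (eta : R) :
  0 < eta <= 1 ->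
  (forall s, Rabs s < eta -> Series (fun n => second_diff q n s) <= 0) ->
  exists c, 0 <= c /\ forall x, 0 < x <= 1 ->
    exists N0, forall N, (N0 <= N)%nat -> riemann_mean q N x <= c * x ^ 3.
Proof.
  intros Heta Hp.
  destruct second_diff_sum_le as [P [HP0 HP]].
  set (e1 := 1 - cos eta).
  assert (HPI : 3 < PI) by (generalize PI2_3_2; lra).
  assert (He1 : 0 < e1).
  { unfold e1. rewrite <- cos_0. generalize (cos_decreasing_1 0 eta). lra. }
  (* For [s >= eta], [ker_den >= 2 r (1 - cos eta) >= (2/3) e1] because [r >= 1/3], and
     [16 / (2/3)^2 = 36]. *)
  set (D := 36 / e1 ^ 2).
  assert (HD : 0 < D) by (apply Rdiv_lt_0_compat; [lra | apply pow_lt; lra]).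
  exists ((D * P + 2) / 2). split; [nra|].
  intros x Hx.
  set (r := exp (- x)). destruct (exp_lt_1 x ltac:(lra)) as [Hr0 Hr1]. fold r in Hr0, Hr1.
  assert (Hr3 : / 3 <= r).
  { unfold r. rewrite exp_Ropp. apply Rinv_le_contravar; [apply exp_pos|].
    apply Rle_trans with (exp 1); [|apply exp_le_3].
    destruct (Req_dec x 1) as [->|]; [lra|]. left. apply exp_increasing; lra. }
  assert (Hx3 : 0 < x ^ 3) by (apply pow_lt; lra).
  (* A crude bound for the kernel near 0, which may depend on the fixed [x]. The truncation errors
     [eps2] of the kernel and [eps1] of the series are chosen after it, so that each contributes at
     most [x^3]; hence the 2 in [D * P + 2]. *)
  set (G := 16 * x ^ 3 / ((1 - r) ^ 2) ^ 2).
  assert (Hr2 : 0 < (1 - r) ^ 2) by (apply pow_lt; lra).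
  assert (HG : 0 <= G). { apply Rdiv_le_0_compat; [lra | apply pow_lt; lra]. }
  set (eps2 := x ^ 3 / (P + 1)).
  assert (He2 : 0 < eps2) by (apply Rdiv_lt_0_compat; lra).
  assert (He2P : eps2 * P <= x ^ 3 - eps2).
  { right. unfold eps2. field. lra. }
  set (eps1 := x ^ 3 / (G + 2 * eps2)).
  assert (He1' : 0 < eps1) by (apply Rdiv_lt_0_compat; lra).
  destruct (Mtest_approx _ _ eps1 second_diff_le ex_series_second_diff_bound He1') as [N0 HN0].
  destruct (ker_limit x eps2 ltac:(lra) He2) as [M0 HM0].
  exists N0. intros N HN.
  set (M := (N + 1 + M0)%nat).
  assert (Bd : forall s, 0 <= s <= PI ->
    ker x M s * sum_n (fun n => second_diff q n s) N <= (D * P + 2) * x ^ 3).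
  { intros s Hs.
    assert (Hk := HM0 M s ltac:(unfold M; lia)). apply Rabs_le_between in Hk.
    assert (Hnum := ker_num_bounds x s Hx).
    destruct (ker_den_ge x s ltac:(lra)) as [Hd1 Hd2]. fold r in Hd1, Hd2.
    assert (HpN := HP N s).
    assert (HpA := HN0 N s HN). apply Rabs_def2 in HpA.
    set (k := ker x M s) in *. set (d := ker_den x s) in *. set (w := ker_num x s) in *.
    assert (Hdp : 0 < d ^ 2) by (apply pow_lt; lra).
    assert (Hw0 : 0 <= w / d ^ 2) by (apply Rdiv_le_0_compat; lra).
    set (p := sum_n (fun n => second_diff q n s) N) in *.
    destruct (Rlt_le_dec s eta) as [Hse|Hse].
    - assert (Hps := Hp s ltac:(rewrite Rabs_pos_eq; lra)).
      assert (Hwg : w / d ^ 2 <= G).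
      { unfold G, Rdiv. apply Rmult_le_compat; [lra | left; apply Rinv_0_lt_compat; lra | lra |].
        apply Rinv_le_contravar; [apply pow_lt; lra|]. apply pow_incr; lra. }
      apply Rabs_le_between in HpN.
      assert (Hpe : p <= eps1) by lra.
      (* The truncated kernel may be slightly negative; raised by [eps2] it is not, and the upper
         bound on [p] can be multiplied by it. *)
      assert (A1 : (k + eps2) * p <= (G + 2 * eps2) * eps1).
      { apply Rle_trans with ((k + eps2) * eps1).
        - apply Rmult_le_compat_l; lra.
        - apply Rmult_le_compat_r; lra. }
      assert (A2 : (G + 2 * eps2) * eps1 = x ^ 3) by (unfold eps1; field; lra).
      assert (A3 : - eps2 * p <= eps2 * P) by nra.
      assert (A4 : 0 <= D * P * x ^ 3) by (apply Rmult_le_pos; [apply Rmult_le_pos|]; lra).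
      nra.
    - assert (Hcs : cos s <= cos eta).
      { destruct (Req_dec s eta) as [->|]; [lra|]. left. apply cos_decreasing_1; lra. }
      assert (Hde : 2 / 3 * e1 <= d).
      { apply Rle_trans with (2 := Hd2). unfold e1 in *. apply Rmult_le_compat; lra. }
      assert (Hwg : w / d ^ 2 <= D * x ^ 3).
      { replace (D * x ^ 3) with (16 * x ^ 3 / (2 / 3 * e1) ^ 2) by (unfold D; field; lra).
        unfold Rdiv. apply Rmult_le_compat; [lra | left; apply Rinv_0_lt_compat; lra | lra |].
        apply Rinv_le_contravar; [apply pow_lt; lra|]. apply pow_incr; lra. }
      apply Rle_trans with (1 := Rle_abs _). rewrite Rabs_mult.
      apply Rle_trans with ((D * x ^ 3 + eps2) * P).
      + apply Rmult_le_compat; [apply Rabs_pos | apply Rabs_pos | | exact HpN].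
        apply Rabs_le_between. lra.
      + nra. }
  assert (I := RInt_ker_second_diff q x M N ltac:(unfold M; lia)).
  assert (U : 2 * PI * riemann_mean q N x <= PI * ((D * P + 2) * x ^ 3)).
  { rewrite <- I. replace (PI * ((D * P + 2) * x ^ 3)) with (RInt (fun _ => (D * P + 2) * x ^ 3) 0 PI).
    2:{ rewrite RInt_const. unfold scal; simpl; unfold mult; simpl. ring. }
    apply RInt_le; [lra | | apply ex_RInt_const | intros s Hs; apply Bd; lra].
    apply ex_RInt_cont. intros s. apply continuous_Rmult; [apply continuous_ker|].
    apply continuous_sum_n. intros n. apply continuous_second_diff. }
  apply Rmult_le_reg_l with (2 * PI); lra.
Qed.

Definition abel_sum (N : nat) (x : R) : R := sum_n (fun n => q n * exp (- (freq n * x))) N.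

Lemma is_derive_riemann_mean (N : nat) (x : R) :
  is_derive (riemann_mean q N) x (x * abel_sum N x).
Proof.
  unfold riemann_mean, abel_sum.
  replace (x * sum_n (fun n => q n * exp (- (freq n * x))) N)
    with (sum_n (fun n => x * (q n * exp (- (freq n * x)))) N)
    by apply (sum_n_mult_l (K := R_Ring)).
  apply (is_derive_sum_n (K := R_AbsRing) (V := R_NormedModule)
   (fun n x => q n * (1 - (1 + freq n * x) * exp (- (freq n * x))) / freq n ^ 2)).
  intros n _. assert (H := freq_ge_1 n). auto_derive; auto. field. lra.
Qed.

(** [s <= e^s - 1], and multiplication by [e^s - 1] makes the geometric majorant telescope. The
    bound is uniform in [N] down to [s = 0], where the Abel sums do not converge uniformly. *)
Lemma abel_sum_le (N : nat) (s : R) : 0 <= s -> Rabs (s * abel_sum N s) <= b.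
Proof.
  intros Hs. rewrite Rabs_mult, Rabs_pos_eq by lra.
  assert (G : (exp s - 1) * Rabs (abel_sum N s) <= b * (1 - exp (- (freq N * s)))).
  { unfold abel_sum. induction N as [|N IH].
    - rewrite sum_O, Rabs_mult, (Rabs_pos_eq (exp _)) by (left; apply exp_pos).
      unfold freq; simpl (INR 1). rewrite Rmult_1_l.
      assert (E : exp s * exp (- s) = 1) by (rewrite <- exp_plus, <- exp_0; f_equal; ring).
      replace ((exp s - 1) * (Rabs (q 0%nat) * exp (- s)))
        with (Rabs (q 0%nat) * (exp s * exp (- s) - exp (- s))) by ring. rewrite E.
      apply Rmult_le_compat_r; [|apply Hq].
      assert (exp (- s) <= exp 0); [|rewrite exp_0 in *; lra].
      destruct (Req_dec s 0) as [->|]; [rewrite Ropp_0; lra|]. left; apply exp_increasing; lra.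
    - rewrite sum_Sn.
      assert (Hs1 : 1 <= exp s).
      { rewrite <- exp_0. destruct (Req_dec s 0) as [->|]; [lra|]. left; apply exp_increasing; lra. }
      assert (E : exp (- (freq N * s)) = exp s * exp (- (freq (S N) * s))).
      { rewrite <- exp_plus. f_equal. unfold freq. rewrite (S_INR (S N)). ring. }
      apply Rle_trans with ((exp s - 1) * (Rabs (sum_n (fun n => q n * exp (- (freq n * s))) N)
         + Rabs (q (S N) * exp (- (freq (S N) * s))))).
      { apply Rmult_le_compat_l; [lra|]. apply Rabs_triang. }
      rewrite Rmult_plus_distr_l. rewrite E in IH.
      rewrite Rabs_mult, (Rabs_pos_eq (exp _)) by (left; apply exp_pos).
      set (Y := exp (- (freq (S N) * s))) in *. assert (HY : 0 < Y) by apply exp_pos.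
      assert ((exp s - 1) * (Rabs (q (S N)) * Y) <= (exp s - 1) * (b * Y)).
      { apply Rmult_le_compat_l; [lra|]. apply Rmult_le_compat_r; [lra|]. apply Hq. }
      lra. }
  assert (Hes := exp_ineq1_le s). assert (Hf := exp_pos (- (freq N * s))).
  apply Rle_trans with ((exp s - 1) * Rabs (abel_sum N s)).
  - apply Rmult_le_compat_r; [apply Rabs_pos | lra].
  - apply Rle_trans with (1 := G). nra.
Qed.

(** The mean is the integral of [s abel_sum(s)]. On [[y, x]] convergence is uniform and the
    truncated sum is at least [gamma / 4]; on [[0, y]] only the bound [-b] is available, and [y] is
    taken so small that the loss [b y] is absorbed. *)
Lemma riemann_mean_lower (gamma delta x : R) :
  0 < gamma -> 0 < delta ->
  (forall y, 0 < y < delta -> gamma / 2 <= Series (fun n => q n * exp (- (freq n * y)))) ->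
  0 < x < delta ->
  exists N0, forall N, (N0 <= N)%nat -> gamma * x ^ 2 / 16 <= riemann_mean q N x.
Proof.
  intros Hg Hd Hu Hx.
  assert (Hx2 : 0 < gamma * x ^ 2) by (apply Rmult_lt_0_compat; [lra | apply pow_lt; lra]).
  set (y := Rmin (x / 4) (gamma * x ^ 2 / (64 * (b + 1)))).
  assert (Hy0 : 0 < y).
  { apply Rmin_glb_lt; [lra|]. apply Rdiv_lt_0_compat; lra. }
  assert (Hy1 : y <= x / 4) by apply Rmin_l.
  assert (Hy2 : b * y <= gamma * x ^ 2 / 64).
  { assert (Hy3 : y <= gamma * x ^ 2 / (64 * (b + 1))) by apply Rmin_r.
    apply Rle_trans with ((b + 1) * (gamma * x ^ 2 / (64 * (b + 1)))).
    - apply Rmult_le_compat; lra.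
    - right. field. lra. }
  destruct (exp_lt_1 y Hy0) as [Hr0 Hr1].
  (* [y + Rabs t] lets all real [t] parametrise the half-line from [y] on, as the majorant is
     required for every [t]. *)
  set (v := fun n t => q n * exp (- (freq n * (y + Rabs t)))).
  assert (Hv : forall n t, Rabs (v n t) <= b * exp (- y) ^ n).
  { intros n t. unfold v. rewrite Rabs_mult, (Rabs_pos_eq (exp _)) by (left; apply exp_pos).
    apply Rmult_le_compat; [apply Rabs_pos | left; apply exp_pos | apply Hq |].
    rewrite pow_exp. left. apply exp_increasing. apply Ropp_lt_contravar.
    unfold freq. rewrite S_INR. generalize (Rabs_pos t) (pos_INR n). intros. nra. }
  assert (Hvs : ex_series (fun n => b * exp (- y) ^ n)).
  { apply (ex_series_scal_l (K := R_AbsRing) (V := R_NormedModule) b), ex_series_geom.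
    rewrite Rabs_pos_eq; lra. }
  destruct (Mtest_approx v _ (gamma / 4) Hv Hvs ltac:(lra)) as [N0 HN0].
  exists N0. intros N HN.
  assert (HuN : forall s, y <= s <= x -> gamma / 4 <= abel_sum N s).
  { intros s Hs. assert (H := HN0 N (s - y) HN). unfold v in H.
    rewrite (Rabs_pos_eq (s - y)) in H by lra.
    replace (y + (s - y)) with s in H by ring.
    apply Rabs_def2 in H. assert (H2 := Hu s ltac:(lra)). unfold abel_sum. lra. }
  assert (L1 : - b * (y - 0) <= riemann_mean q N y - riemann_mean q N 0).
  { apply (is_derive_le_MVT _ (fun t => t * abel_sum N t)); [lra | |].
    - intros t _. apply is_derive_riemann_mean.
    - intros t Ht. assert (H := abel_sum_le N t ltac:(lra)). apply Rabs_le_between in H. lra. }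
  assert (R0 : riemann_mean q N 0 = 0).
  { unfold riemann_mean. rewrite (sum_n_ext _ (fun _ => 0)).
    - clear -N. induction N as [|N IH]; [now rewrite sum_O|].
      rewrite sum_Sn, IH. unfold plus; simpl. ring.
    - intros n. rewrite Rmult_0_r, Ropp_0, exp_0. unfold Rdiv. eq_R. ring. }
  assert (L2 : 0 * (x - y) <= (riemann_mean q N x - gamma / 8 * x ^ 2)
                              - (riemann_mean q N y - gamma / 8 * y ^ 2)).
  { apply (is_derive_le_MVT (fun t => riemann_mean q N t - gamma / 8 * t ^ 2)
             (fun t => t * abel_sum N t - gamma / 4 * t)); [lra | |].
    - intros t _. apply (is_derive_minus (riemann_mean q N)).
      + apply is_derive_riemann_mean.
      + auto_derive; auto. field.
    - intros t Ht. assert (H := HuN t Ht). nra. }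
  assert (y ^ 2 <= x ^ 2 / 16) by nra.
  assert (gamma * y ^ 2 <= gamma * (x ^ 2 / 16)) by (apply Rmult_le_compat_l; lra).
  lra.
Qed.

(** For [gamma > 0] the mean would be at least [gamma x^2 / 16] and at most [c x^3], which fails for
    small [x]. *)
Lemma abel_limit_nonpos (eta gamma : R) :
  0 < eta ->
  (forall eps, 0 < eps -> exists delta, 0 < delta /\ forall x, 0 < x < delta ->
     Rabs (Series (fun n => q n * exp (- (freq n * x))) - gamma) < eps) ->
  (forall s, Rabs s < eta -> Series (fun n => second_diff q n s) <= 0) ->
  gamma <= 0.
Proof.
  intros Heta Hl Hp. apply Rnot_lt_le. intros Hg.
  destruct (riemann_mean_upper (Rmin eta 1)) as [c [Hc Hup]].
  { split; [apply Rmin_glb_lt; lra | apply Rmin_r]. }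
  { intros s Hs. apply Hp. apply Rlt_le_trans with (1 := Hs), Rmin_l. }
  destruct (Hl (gamma / 2) ltac:(lra)) as [delta [Hd Hdx]].
  set (m := Rmin (delta / 2) (gamma / (32 * (c + 1)))).
  assert (Hm0 : 0 < m). { apply Rmin_glb_lt; [lra|]. apply Rdiv_lt_0_compat; lra. }
  set (x := Rmin m 1).
  assert (Hx0 : 0 < x) by (apply Rmin_glb_lt; lra).
  assert (Hx1 : x <= 1) by apply Rmin_r.
  assert (Hxm : x <= m) by apply Rmin_l.
  assert (Hm1 : m <= delta / 2) by apply Rmin_l.
  assert (Hm2 : m <= gamma / (32 * (c + 1))) by apply Rmin_r.
  destruct (riemann_mean_lower gamma delta x) as [N1 H1]; auto; try lra.
  { intros y Hy. specialize (Hdx y Hy). apply Rabs_def2 in Hdx. lra. }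
  destruct (Hup x) as [N2 H2]; [lra|].
  specialize (H1 (N1 + N2)%nat ltac:(lia)). specialize (H2 (N1 + N2)%nat ltac:(lia)).
  assert (H : gamma * x ^ 2 / 16 <= c * x ^ 3) by lra.
  assert (Hx2 : 0 < x ^ 2) by (apply pow_lt; lra).
  assert (Hcx : c * x <= gamma / 32).
  { apply Rle_trans with ((c + 1) * (gamma / (32 * (c + 1)))).
    - apply Rmult_le_compat; lra.
    - right. field. lra. }
  assert (c * x ^ 3 <= gamma / 32 * x ^ 2).
  { replace (c * x ^ 3) with (c * x * x ^ 2) by ring. apply Rmult_le_compat_r; lra. }
  nra.
Qed.
End Riemann.

(** Radial approach in the variable [x = - ln (r / R0)]. *)
Definition abel_tends (q : nat -> R) (gamma : R) : Prop :=
  forall eps, 0 < eps -> exists delta, 0 < delta /\ forall x, 0 < x < delta ->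
    Rabs (Series (fun n => q n * exp (- (freq n * x))) - gamma) < eps.

Lemma ex_series_abel (q : nat -> R) (b x : R) :
  (forall n, Rabs (q n) <= b) -> 0 < x -> ex_series (fun n => q n * exp (- (freq n * x))).
Proof.
  intros Hq Hx. destruct (exp_lt_1 x Hx) as [H0 H1].
  apply (ex_series_dom _ (fun n => b * exp (- x) ^ n)).
  - intros n. rewrite Rabs_mult, (Rabs_pos_eq (exp _)) by (left; apply exp_pos).
    apply Rmult_le_compat; [apply Rabs_pos | left; apply exp_pos | apply Hq |].
    rewrite pow_exp. left. apply exp_increasing, Ropp_lt_contravar.
    unfold freq. rewrite S_INR. lra.
  - apply (ex_series_scal_l (K := R_AbsRing) (V := R_NormedModule) b), ex_series_geom.
    rewrite Rabs_pos_eq; lra.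
Qed.

Lemma ex_series_second_diff (q : nat -> R) (b s : R) :
  (forall n, Rabs (q n) <= b) -> ex_series (fun n => second_diff q n s).
Proof.
  intros Hq. apply (ex_series_dom _ _ (fun n => second_diff_le q b Hq n s)).
  apply ex_series_second_diff_bound.
Qed.

(** Subtracting [lambda] from the coefficient of frequency 1 lowers the Abel limit by [lambda] and
    the second difference by exactly [2 lambda (1 - cos s)]. This is why the comparison function is
    [2 (1 - cos s)] rather than [s^2]. *)
Lemma abel_limit_le (q : nat -> R) (b eta gamma lambda : R) :
  (forall n, Rabs (q n) <= b) -> 0 < eta -> abel_tends q gamma ->
  (forall s, Rabs s < eta ->
     Series (fun n => second_diff q n s) <= 2 * lambda * (1 - cos s)) ->
  gamma <= lambda.
Proof.
  intros Hq Heta Hl Hp.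
  set (q0 := fun n : nat => match n with O => lambda | _ => 0 end).
  set (q' := fun n => q n - q0 n).
  assert (Hq0 : forall n, Rabs (q0 n) <= Rabs lambda).
  { intros [|n]; simpl; [lra | rewrite Rabs_R0; apply Rabs_pos]. }
  assert (Hq' : forall n, Rabs (q' n) <= b + Rabs lambda).
  { intros n. unfold q'. apply Rle_trans with (1 := Rabs_triang _ _). rewrite Rabs_Ropp.
    apply Rplus_le_compat; auto. }
  assert (S0 : forall f : nat -> R, (forall k, k <> 0%nat -> f k = 0) -> Series f = f 0%nat).
  { intros f Hf. now apply is_series_unique, is_series_single. }
  enough (gamma - lambda <= 0) by lra.
  apply (abel_limit_nonpos q' _ Hq' eta); auto.
  - intros eps He. destruct (Hl (eps / 2) ltac:(lra)) as [d1 [Hd1 H1]].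
    set (m := eps / (2 * (Rabs lambda + 1))).
    assert (Hlp := Rabs_pos lambda).
    assert (Hm : 0 < m) by (apply Rdiv_lt_0_compat; lra).
    exists (Rmin d1 m). split; [apply Rmin_glb_lt; lra|]. intros x Hx.
    assert (Hx1 : x < d1) by (apply Rlt_le_trans with (1 := proj2 Hx), Rmin_l).
    assert (Hx2 : x < m) by (apply Rlt_le_trans with (1 := proj2 Hx), Rmin_r).
    rewrite (Series_ext _ (fun n => q n * exp (- (freq n * x)) - q0 n * exp (- (freq n * x)))).
    2:{ intros n. unfold q'. ring. }
    rewrite Series_minus.
    2, 3: eapply ex_series_abel; eauto; lra.
    rewrite (S0 (fun n => q0 n * exp (- (freq n * x)))).
    2:{ intros [|k] Hk; [easy|]. simpl. ring. }
    assert (E1 : freq 0 = 1) by reflexivity. rewrite E1, Rmult_1_l. simpl q0.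
    specialize (H1 x ltac:(lra)).
    destruct (exp_lt_1 x ltac:(lra)) as [H2 H3]. assert (H4 := exp_ineq1_le (- x)).
    replace (Series (fun n => q n * exp (- (freq n * x))) - lambda * exp (- x) - (gamma - lambda))
      with ((Series (fun n => q n * exp (- (freq n * x))) - gamma) + lambda * (1 - exp (- x))) by ring.
    apply Rle_lt_trans with (1 := Rabs_triang _ _).
    rewrite Rabs_mult, (Rabs_pos_eq (1 - _)) by lra.
    assert (Rabs lambda * (1 - exp (- x)) <= (Rabs lambda + 1) * m).
    { apply Rmult_le_compat; lra. }
    assert ((Rabs lambda + 1) * m = eps / 2) by (unfold m; field; lra).
    lra.
  - intros s Hs. specialize (Hp s Hs).
    rewrite (Series_ext _ (fun n => second_diff q n s - second_diff q0 n s)).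
    2:{ intros n. unfold second_diff, q'. assert (H := freq_ge_1 n). field. lra. }
    rewrite Series_minus by (eapply ex_series_second_diff; eauto).
    rewrite (S0 (fun n => second_diff q0 n s)).
    2:{ intros [|k] Hk; [easy|]. unfold second_diff. simpl q0. unfold Rdiv. ring. }
    unfold second_diff at 2. assert (E1 : freq 0 = 1) by reflexivity. rewrite E1, Rmult_1_l.
    simpl q0. replace (2 * lambda * (1 - cos s) / 1 ^ 2) with (2 * lambda * (1 - cos s)) by field.
    lra.
Qed.

(** * Riemann's uniqueness argument *)

Lemma even_convex_nonneg (H H1 H2 : R -> R) :
  (forall s, is_derive H s (H1 s)) -> (forall s, is_derive H1 s (H2 s)) ->
  (forall s, H (- s) = H s) -> H 0 = 0 -> H1 0 = 0 -> continuous H2 0 -> 0 < H2 0 ->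
  exists eta, 0 < eta /\ forall s, Rabs s < eta -> 0 <= H s.
Proof.
  intros D1 D2 Hev H00 H10 Hc Hp.
  destruct (proj1 (filterlim_locally _ _) Hc (mkposreal _ Hp)) as [eta Heta].
  assert (P2 : forall s, 0 <= s < eta -> 0 <= H2 s).
  { intros s Hs. assert (B : ball 0 eta s).
    { unfold ball; simpl; unfold AbsRing_ball, abs, minus, plus, opp; simpl.
      rewrite Rabs_pos_eq; lra. }
    specialize (Heta s B).
    unfold ball in Heta; simpl in Heta; unfold AbsRing_ball, abs, minus, plus, opp in Heta;
      simpl in Heta. apply Rabs_def2 in Heta. lra. }
  assert (P1 : forall s, 0 <= s < eta -> 0 <= H1 s).
  { intros s Hs. assert (0 * (s - 0) <= H1 s - H1 0); [|lra].
    apply (is_derive_le_MVT H1 H2); [lra | auto |]. intros t Ht. apply P2; lra. }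
  assert (P0 : forall s, 0 <= s < eta -> 0 <= H s).
  { intros s Hs. assert (0 * (s - 0) <= H s - H 0); [|lra].
    apply (is_derive_le_MVT H H1); [lra | auto |]. intros t Ht. apply P1; lra. }
  exists eta. split; [apply eta|]. intros s Hs. apply Rabs_def2 in Hs.
  destruct (Rle_dec 0 s); [apply P0; lra | rewrite <- Hev; apply P0; lra].
Qed.

(* Formally, the second derivative is [Re (sum_{n >= 1} c_n e^{int})]. *)
Definition riemann_fun (c : nat -> C) (t : R) : R :=
  Series (fun n => - Re (c (S n) * cis (freq n * t)) / freq n ^ 2).

Lemma riemann_term_le (c : nat -> C) (b : R) (n : nat) (t : R) :
  (forall n, Cmod (c n) <= b) ->
  Rabs (- Re (c (S n) * cis (freq n * t)) / freq n ^ 2) <= b * / freq n ^ 2.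
Proof.
  intros Hc. unfold Rdiv. assert (H := freq_ge_1 n).
  assert (Hi : 0 < / freq n ^ 2) by (apply Rinv_0_lt_compat, pow_lt; lra).
  rewrite Rabs_mult, Rabs_Ropp, (Rabs_pos_eq (/ _)) by lra.
  apply Rmult_le_compat_r; [lra|]. apply Rle_trans with (2 := Hc (S n)). apply Re_mult_cis_le.
Qed.

Lemma ex_series_riemann_bound (b : R) : ex_series (fun n => b * / freq n ^ 2).
Proof. apply (ex_series_scal_l (K := R_AbsRing) (V := R_NormedModule) b), freq_sq_series. Qed.

Lemma continuous_riemann_term (c : nat -> C) (n : nat) (t : R) :
  continuous (fun t => - Re (c (S n) * cis (freq n * t)) / freq n ^ 2) t.
Proof.
  apply (continuous_Rmult (fun t => - Re (c (S n) * cis (freq n * t))) (fun _ => / freq n ^ 2)).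
  - apply (continuous_opp (fun t => Re (c (S n) * cis (freq n * t)))). apply continuous_Re_cis.
  - apply continuous_const.
Qed.

Lemma continuous_riemann_fun (c : nat -> C) (b t : R) :
  (forall n, Cmod (c n) <= b) -> continuous (riemann_fun c) t.
Proof.
  intros Hc.
  apply (Mtest_continuous (fun n t => - Re (c (S n) * cis (freq n * t)) / freq n ^ 2)
     (fun n => b * / freq n ^ 2)).
  - intros; now apply riemann_term_le.
  - apply ex_series_riemann_bound.
  - intros; apply continuous_riemann_term.
Qed.

Lemma riemann_fun_second_diff (c : nat -> C) (b t s : R) :
  (forall n, Cmod (c n) <= b) ->
  riemann_fun c (t + s) + riemann_fun c (t - s) - 2 * riemann_fun c t =
  Series (fun n => second_diff (fun n => Re (c (S n) * cis (freq n * t))) n s).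
Proof.
  intros Hc. unfold riemann_fun.
  assert (X : forall t, ex_series (fun n => - Re (c (S n) * cis (freq n * t)) / freq n ^ 2)).
  { intros t'. apply (ex_series_dom _ _ (fun n => riemann_term_le c b n t' Hc)).
    apply ex_series_riemann_bound. }
  rewrite <- Series_plus by auto. rewrite <- Series_scal_l, <- Series_minus.
  - apply Series_ext. intros n. unfold second_diff. assert (H := freq_ge_1 n).
    rewrite !Re_mult_cis, Rmult_plus_distr_l, Rmult_minus_distr_l.
    rewrite cos_plus, cos_minus, sin_plus, sin_minus. field. lra.
  - now apply (ex_series_plus (K := R_AbsRing) (V := R_NormedModule)).
  - apply (ex_series_scal_l (K := R_AbsRing) (V := R_NormedModule) 2), X.
Qed.

(* Riemann's argument: at an interior maximum of [riemann_fun c - G - affine],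
   tilted by a small parabola, the second differences would contradict the Abel
   limit. *)
Lemma riemann_fun_below_chord (c : nat -> C) (b : R) (gamma G G1 : R -> R) (l1 l0 a d : R) :
  (forall n, Cmod (c n) <= b) ->
  (forall t, abel_tends (fun n => Re (c (S n) * cis (freq n * t))) (gamma t)) ->
  (forall t, continuous gamma t) ->
  (forall t, is_derive G t (G1 t)) -> (forall t, is_derive G1 t (gamma t)) ->
  riemann_fun c a - G a <= l1 * a + l0 -> riemann_fun c d - G d <= l1 * d + l0 ->
  forall t, a <= t <= d -> riemann_fun c t - G t <= l1 * t + l0.
Proof.
  intros Hc Hab Hgc HG HG1 Ha Hd t1 Ht1. apply Rnot_lt_le. intros Hlt.
  set (p := riemann_fun c t1 - G t1 - (l1 * t1 + l0)).
  assert (Hp : 0 < p) by (unfold p; lra).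
  set (e := p / (2 * ((t1 - a) * (d - t1) + 1))).
  assert (Hta : 0 <= (t1 - a) * (d - t1)) by (apply Rmult_le_pos; lra).
  assert (He : 0 < e) by (apply Rdiv_lt_0_compat; lra).
  (* The parabola vanishes at [a] and [d], where [Z <= 0], and [e] is small enough to keep
     [Z t1 > 0]; so the maximum is interior. *)
  set (Z := fun t => riemann_fun c t - G t - (l1 * t + l0) + e * ((t - a) * (t - d))).
  assert (HZ1 : 0 < Z t1).
  { unfold Z. fold p.
    assert (e * ((t1 - a) * (d - t1) + 1) = p / 2) by (unfold e; field; lra). nra. }
  assert (HZc : forall t, continuous Z t).
  { intros t.
    apply (continuous_plus (fun t => riemann_fun c t - G t - (l1 * t + l0))
            (fun t => e * ((t - a) * (t - d)))).
    - apply (continuous_minus (fun t => riemann_fun c t - G t) (fun t => l1 * t + l0)).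
      + apply (continuous_minus (riemann_fun c) G).
        * now apply continuous_riemann_fun with b.
        * apply (ex_derive_continuous G). now exists (G1 t).
      + apply (ex_derive_continuous (fun t => l1 * t + l0)). auto_derive; auto.
    - apply (ex_derive_continuous (fun t => e * ((t - a) * (t - d)))). auto_derive; auto. }
  destruct (continuity_ab_maj Z a d ltac:(lra)) as [t0 [Hmax Ht0]].
  { intros t _. apply continuity_pt_filterlim, HZc. }
  assert (HZ0 : 0 < Z t0) by (apply Rlt_le_trans with (1 := HZ1), Hmax; lra).
  assert (Ht0a : a < t0).
  { destruct (Req_dec a t0) as [E|]; [|lra]. unfold Z in HZ0. rewrite <- E in HZ0.
    replace (a - a) with 0 in HZ0 by ring. lra. }
  assert (Ht0d : t0 < d).
  { destruct (Req_dec t0 d) as [E|]; [|lra]. unfold Z in HZ0. rewrite E in HZ0.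
    replace (d - d) with 0 in HZ0 by ring. lra. }
  (* At the maximum, the second difference of [riemann_fun c] is at most that of [G] minus
     [2 e s^2], about [(gamma t0 - 2 e) s^2]. This is below [2 lambda (1 - cos s)] near 0, the
     difference having second derivative [2 e] there, so [gamma t0 <= gamma t0 - e] would follow. *)
  set (lambda := gamma t0 - e).
  destruct (even_convex_nonneg
    (fun s => 2 * lambda * (1 - cos s) + 2 * e * s ^ 2 - (G (t0 + s) + G (t0 - s) - 2 * G t0))
    (fun s => 2 * lambda * sin s + 4 * e * s - (G1 (t0 + s) - G1 (t0 - s)))
    (fun s => 2 * lambda * cos s + 4 * e - (gamma (t0 + s) + gamma (t0 - s))))
    as [eta [Heta HH]].
  - intros s.
    assert (A1 : is_derive (fun s => G (t0 + s)) s (G1 (t0 + s))).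
    { replace (G1 (t0 + s)) with (1 * G1 (t0 + s)) by ring.
      apply (is_derive_comp G (fun s => t0 + s)); [apply HG|]. auto_derive; auto. }
    assert (A2 : is_derive (fun s => G (t0 - s)) s (- G1 (t0 - s))).
    { replace (- G1 (t0 - s)) with (-1 * G1 (t0 - s)) by ring.
      apply (is_derive_comp G (fun s => t0 - s)); [apply HG|]. auto_derive; auto; try ring. }
    apply (is_derive_minus (fun s => 2 * lambda * (1 - cos s) + 2 * e * s ^ 2)
      (fun s => G (t0 + s) + G (t0 - s) - 2 * G t0)).
    + auto_derive; auto. ring.
    + replace (G1 (t0 + s) - G1 (t0 - s)) with (minus (plus (G1 (t0 + s)) (- G1 (t0 - s))) 0).
      * apply (is_derive_minus (fun s => G (t0 + s) + G (t0 - s)) (fun _ => 2 * G t0)).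
        -- now apply (is_derive_plus (fun s => G (t0 + s)) (fun s => G (t0 - s))).
        -- apply (is_derive_const (2 * G t0)).
      * unfold minus, plus, opp; simpl. ring.
  - intros s.
    assert (A1 : is_derive (fun s => G1 (t0 + s)) s (gamma (t0 + s))).
    { replace (gamma (t0 + s)) with (1 * gamma (t0 + s)) by ring.
      apply (is_derive_comp G1 (fun s => t0 + s)); [apply HG1|]. auto_derive; auto. }
    assert (A2 : is_derive (fun s => G1 (t0 - s)) s (- gamma (t0 - s))).
    { replace (- gamma (t0 - s)) with (-1 * gamma (t0 - s)) by ring.
      apply (is_derive_comp G1 (fun s => t0 - s)); [apply HG1|]. auto_derive; auto; try ring. }
    apply (is_derive_minus (fun s => 2 * lambda * sin s + 4 * e * s)
      (fun s => G1 (t0 + s) - G1 (t0 - s))).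
    + auto_derive; auto. ring.
    + replace (gamma (t0 + s) + gamma (t0 - s)) with (minus (gamma (t0 + s)) (- gamma (t0 - s))).
      * now apply (is_derive_minus (fun s => G1 (t0 + s)) (fun s => G1 (t0 - s))).
      * unfold minus, plus, opp; simpl. ring.
  - intros s. rewrite cos_neg. unfold Rminus. rewrite Ropp_involutive. ring.
  - rewrite cos_0, Rplus_0_r, Rminus_0_r. ring.
  - rewrite sin_0, Rplus_0_r, Rminus_0_r. ring.
  - apply (continuous_minus (fun s => 2 * lambda * cos s + 4 * e)
      (fun s => gamma (t0 + s) + gamma (t0 - s))).
    + apply (ex_derive_continuous (fun s => 2 * lambda * cos s + 4 * e)). auto_derive; auto.
    + apply (continuous_plus (fun s => gamma (t0 + s)) (fun s => gamma (t0 - s)));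
      [apply (continuous_comp (fun s => t0 + s) gamma) | apply (continuous_comp (fun s => t0 - s) gamma)];
      auto;
      [apply (ex_derive_continuous (fun s => t0 + s)) | apply (ex_derive_continuous (fun s => t0 - s))];
      auto_derive; auto.
  - rewrite cos_0, Rplus_0_r, Rminus_0_r. unfold lambda. lra.
  - enough (gamma t0 <= lambda) by (unfold lambda in *; lra).
    apply (abel_limit_le (fun n => Re (c (S n) * cis (freq n * t0))) b (Rmin eta (Rmin (t0 - a) (d - t0))) (gamma t0) lambda
       (fun n => Rle_trans _ _ _ (Re_mult_cis_le (c (S n)) (freq n * t0)) (Hc (S n)))).
    + repeat apply Rmin_glb_lt; lra.
    + apply Hab.
    + intros s Hs. rewrite <- (riemann_fun_second_diff c b) by exact Hc.
      assert (Hs1 : Rabs s < eta) by (apply Rlt_le_trans with (1 := Hs), Rmin_l).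
      assert (Hs2 : Rabs s < Rmin (t0 - a) (d - t0)) by (apply Rlt_le_trans with (1 := Hs), Rmin_r).
      assert (Hs3 : Rabs s < t0 - a) by (apply Rlt_le_trans with (1 := Hs2), Rmin_l).
      assert (Hs4 : Rabs s < d - t0) by (apply Rlt_le_trans with (1 := Hs2), Rmin_r).
      specialize (HH s Hs1). simpl in HH. apply Rabs_def2 in Hs3, Hs4.
      assert (M1 := Hmax (t0 + s) ltac:(lra)). assert (M2 := Hmax (t0 - s) ltac:(lra)).
      unfold Z in M1, M2. nra.
Qed.

Lemma riemann_fun_opp (c : nat -> C) (t : R) :
  riemann_fun (fun n => - c n)%C t = - riemann_fun c t.
Proof.
  unfold riemann_fun. rewrite <- Series_opp. apply Series_ext. intros n.
  replace (Re (- c (S n) * cis (freq n * t))) with (- Re (c (S n) * cis (freq n * t))).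
  - unfold Rdiv. ring.
  - rewrite !Re_mult_cis. destruct (c (S n)). simpl. ring.
Qed.

(** The chord through the end points bounds the difference from above for [c], and from below by the
    same bound for [- c]. *)
Lemma riemann_fun_affine (c : nat -> C) (b : R) (gamma G G1 : R -> R) (a d : R) :
  a < d ->
  (forall n, Cmod (c n) <= b) ->
  (forall t, abel_tends (fun n => Re (c (S n) * cis (freq n * t))) (gamma t)) ->
  (forall t, continuous gamma t) ->
  (forall t, is_derive G t (G1 t)) -> (forall t, is_derive G1 t (gamma t)) ->
  exists l1 l0, forall t, a <= t <= d -> riemann_fun c t = G t + l1 * t + l0.
Proof.
  intros Had Hc Hab Hgc HG HG1.
  set (W := fun t => riemann_fun c t - G t).
  set (l1 := (W d - W a) / (d - a)). set (l0 := W a - l1 * a).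
  assert (Ea : W a = l1 * a + l0) by (unfold l0; ring).
  assert (Ed : W d = l1 * d + l0) by (unfold l0, l1; field; lra).
  exists l1, l0. intros t Ht.
  assert (U := riemann_fun_below_chord c b gamma G G1 l1 l0 a d Hc Hab Hgc HG HG1
     (Req_le _ _ Ea) (Req_le _ _ Ed) t Ht).
  assert (V : riemann_fun (fun n => - c n)%C t - - G t <= - l1 * t + - l0).
  { apply (riemann_fun_below_chord (fun n => - c n)%C b (fun t => - gamma t) (fun t => - G t)
      (fun t => - G1 t) (- l1) (- l0) a d); auto.
    - intros n. now rewrite Cmod_opp.
    - intros s eps He. destruct (Hab s eps He) as [delta [Hd H]].
      exists delta. split; auto. intros x Hx. specialize (H x Hx).
      rewrite (Series_ext _ (fun n => - (Re (c (S n) * cis (freq n * s)) * exp (- (freq n * x))))).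
      + rewrite Series_opp, <- Rabs_Ropp.
        match goal with |- Rabs ?u < _ => replace u with
          (Series (fun n => Re (c (S n) * cis (freq n * s)) * exp (- (freq n * x))) - gamma s) by ring end.
        exact H.
      + intros n. rewrite !Re_mult_cis. destruct (c (S n)). simpl. ring.
    - intros s. now apply (continuous_opp gamma).
    - intros s. now apply (is_derive_opp G).
    - intros s. now apply (is_derive_opp G1).
    - rewrite riemann_fun_opp. unfold W in Ea. lra.
    - rewrite riemann_fun_opp. unfold W in Ed. lra. }
  rewrite riemann_fun_opp in V. lra.
Qed.

(** * Fourier coefficients *)

Lemma RInt_shift (f : R -> R) (v a b : R) :
  (forall t, continuous f t) -> RInt (fun t => f (t + v)) a b = RInt f (a + v) (b + v).
Proof.
  intros Hf.
  assert (H := RInt_comp_lin (V := R_CompleteNormedModule) f 1 v a b).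
  rewrite !Rmult_1_l in H. rewrite <- H by now apply ex_RInt_cont.
  apply RInt_ext. intros t _. change (f (t + v) = 1 * f (1 * t + v)). now rewrite !Rmult_1_l.
Qed.

Lemma RInt_periodic (f : R -> R) (T h : R) :
  (forall t, continuous f t) -> (forall t, f (t + T) = f t) ->
  RInt f h (h + T) = RInt f 0 T.
Proof.
  intros Hf HT.
  assert (X : forall a b, ex_RInt f a b) by (intros; now apply ex_RInt_cont).
  rewrite <- (RInt_Chasles f h T (h + T)) by auto.
  rewrite <- (RInt_Chasles f 0 h T) by auto.
  replace (RInt f T (h + T)) with (RInt f 0 h).
  - unfold plus; simpl. ring.
  - rewrite <- (Rplus_0_l T) at 1. rewrite <- RInt_shift by exact Hf.
    apply RInt_ext. intros t _. now rewrite HT.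
Qed.

Lemma periodic_derive (h h1 : R -> R) (T : R) :
  (forall t, is_derive h t (h1 t)) -> (forall t, h (t + T) = h t) ->
  forall t, h1 (t + T) = h1 t.
Proof.
  intros Hd HT t. rewrite <- (is_derive_unique _ _ _ (Hd t)). symmetry. apply is_derive_unique.
  apply is_derive_ext with (fun s => h (s + T)); [exact HT|].
  replace (h1 (t + T)) with (1 * h1 (t + T)) by ring.
  apply (is_derive_comp h (fun s => s + T)); [apply Hd|]. auto_derive; auto.
Qed.

(** For real [h] this is the real part of [w] times the unnormalised Fourier coefficient; varying
    [w] recovers the complex value. *)
Definition fourier (h : R -> R) (n : nat) (w : C) : R :=
  RInt (fun t => h t * Re (w * cis (- INR n * t))) 0 (2 * PI).

(** Integration by parts, with boundary terms cancelling by periodicity. Differentiability is asked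
    on one period only, because the Riemann function is identified with a smooth one on a bounded
    interval. *)
Lemma fourier_derive (h h1 : R -> R) (n : nat) (w : C) :
  (forall t, 0 <= t <= 2 * PI -> is_derive h t (h1 t)) ->
  (forall t, continuous h1 t) -> h 0 = h (2 * PI) ->
  fourier h1 n w = fourier h n (Ci * INR n * w).
Proof.
  intros Hd Hc Hp. unfold fourier.
  assert (H2 : 0 <= 2 * PI) by (generalize PI_RGT_0; lra).
  set (e := fun v t => Re (v * cis (- INR n * t))).
  set (v := (Ci * INR n * w)%C).
  assert (Hce : forall u t, continuous (e u) t) by (intros; apply continuous_Re_cis).
  assert (Hch : forall t, 0 <= t <= 2 * PI -> continuous h t).
  { intros t Ht. apply (ex_derive_continuous h). exists (h1 t). now apply Hd. }
  assert (De : forall t, is_derive (e w) t (- e v t)).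
  { intros t. unfold e, v.
    apply is_derive_ext with (fun t => Re w * cos (- INR n * t) - Im w * sin (- INR n * t)).
    { intros s. now rewrite Re_mult_cis. }
    rewrite Re_mult_cis. auto_derive; auto. destruct w as [w1 w2]. simpl. ring. }
  set (P := fun t => h t * e w t).
  assert (I : is_RInt (fun t => h1 t * e w t - h t * e v t) 0 (2 * PI) (minus (P (2 * PI)) (P 0))).
  { apply (is_RInt_derive P); rewrite Rmin_left, Rmax_right by exact H2; intros t Ht.
    - unfold P. replace (h1 t * e w t - h t * e v t)
        with (plus (mult (h1 t) (e w t)) (mult (h t) (- e v t)))
        by (unfold plus, mult; simpl; ring).
      apply (is_derive_mult h (e w)); [now apply Hd | apply De | intros; apply Rmult_comm].
    - apply (continuous_minus (fun t => h1 t * e w t) (fun t => h t * e v t));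
      apply continuous_Rmult; auto. }
  assert (E0 : minus (P (2 * PI)) (P 0) = 0).
  { unfold P. rewrite Hp.
    replace (e w (2 * PI)) with (e w 0); [unfold minus, plus, opp; simpl; ring|].
    unfold e. f_equal. f_equal.
    replace (- INR n * (2 * PI)) with (- INR n * 0 + 2 * IZR (- Z.of_nat n) * PI).
    - now rewrite cis_2PI.
    - rewrite opp_IZR, <- INR_IZR_INZ. ring. }
  rewrite E0 in I. apply (is_RInt_unique (V := R_CompleteNormedModule)) in I.
  assert (X1 : ex_RInt (fun t => h1 t * e w t) 0 (2 * PI)).
  { apply ex_RInt_cont; intros. apply continuous_Rmult; auto. }
  assert (X2 : ex_RInt (fun t => h t * e v t) 0 (2 * PI)).
  { apply (ex_RInt_continuous (V := R_CompleteNormedModule)).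
    rewrite Rmin_left, Rmax_right by exact H2. intros t Ht. apply continuous_Rmult; auto. }
  assert (J := RInt_minus (V := R_CompleteNormedModule) _ _ _ _ X1 X2).
  change (RInt (fun t => h1 t * e w t) 0 (2 * PI) = RInt (fun t => h t * e v t) 0 (2 * PI)).
  apply Rminus_diag_uniq. exact (eq_trans (eq_sym J) I).
Qed.

Lemma fourier_iter (E : nat -> R -> R) (m n : nat) (w : C) :
  (forall j t, (j < m)%nat -> 0 <= t <= 2 * PI -> is_derive (E j) t (E (S j) t)) ->
  (forall j t, (j < m)%nat -> continuous (E (S j)) t) ->
  (forall j, (j < m)%nat -> E j 0 = E j (2 * PI)) ->
  fourier (E m) n w = fourier (E O) n (Cpow (Ci * INR n) m * w).
Proof.
  revert w. induction m as [|m IH]; intros w Hd Hc Hp.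
  - simpl. now rewrite Cmult_1_l.
  - rewrite (fourier_derive (E m) (E (S m))) by auto.
    rewrite IH by auto. f_equal. simpl. ring.
Qed.

Lemma Re_mult_Re_cis (c w : C) (p q : R) :
  Re (c * cis p) * Re (w * cis (- q)) =
  / 2 * (Re (c * w * cis (p - q)) + Re (c * Cconj w * cis (p + q))).
Proof.
  rewrite !Re_mult_cis, cos_neg, sin_neg, cos_minus, sin_minus, cos_plus, sin_plus.
  destruct c, w. simpl. field.
Qed.

(** The product of two real parts splits into the frequencies [n - m] and [n + m + 2]; the second is
    never 0, the first only for [n = m]. Half of the product survives, hence [PI] and not [2 PI]. *)
Lemma fourier_riemann_fun (c : nat -> C) (b : R) (m : nat) (w : C) :
  (forall n, Cmod (c n) <= b) ->
  fourier (riemann_fun c) (S m) w = - PI * Re (c (S m) * w) / freq m ^ 2.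
Proof.
  intros Hc. unfold fourier.
  set (u := fun n t => - Re (c (S n) * cis (freq n * t)) / freq n ^ 2
                       * Re (w * cis (- INR (S m) * t))).
  rewrite (RInt_ext _ (fun t => Series (fun n => u n t))).
  2:{ intros t _. unfold riemann_fun, u. now rewrite Series_scal_r. }
  assert (H2 : 0 <= 2 * PI) by (generalize PI_RGT_0; lra).
  assert (S : is_series (fun n => RInt (u n) 0 (2 * PI))
                (RInt (fun t => Series (fun n => u n t)) 0 (2 * PI))).
  { apply (Mtest_RInt u (fun n => b * / freq n ^ 2 * Cmod w)); auto.
    - intros n t. unfold u. rewrite Rabs_mult. apply Rmult_le_compat; try apply Rabs_pos.
      + now apply riemann_term_le.
      + apply Re_mult_cis_le.
    - apply ex_series_scal_r, ex_series_riemann_bound.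
    - intros n t. apply continuous_Rmult; [apply continuous_riemann_term | apply continuous_Re_cis]. }
  rewrite <- (is_series_unique _ _ S).
  assert (I : forall n, RInt (u n) 0 (2 * PI) =
    - / (2 * freq n ^ 2) *
     (RInt (fun t => Re (c (Datatypes.S n) * w * cis (IZR (Z.of_nat n - Z.of_nat m) * t))) 0 (2 * PI)
      + RInt (fun t => Re (c (Datatypes.S n) * Cconj w * cis (IZR (Z.of_nat n + Z.of_nat m + 2) * t))) 0 (2 * PI))).
  { intros n. assert (Hf := freq_ge_1 n).
    rewrite <- (RInt_plus (V := R_CompleteNormedModule))
      by (apply ex_RInt_cont; intros; apply continuous_Re_cis).
    rewrite <- (RInt_scal (V := R_CompleteNormedModule)).
    - apply RInt_ext. intros t _. unfold u.
      change (- Re (c (Datatypes.S n) * cis (freq n * t)) / freq n ^ 2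
          * Re (w * cis (- INR (Datatypes.S m) * t)) =
        - / (2 * freq n ^ 2) *
        (Re (c (Datatypes.S n) * w * cis (IZR (Z.of_nat n - Z.of_nat m) * t)) +
         Re (c (Datatypes.S n) * Cconj w * cis (IZR (Z.of_nat n + Z.of_nat m + 2) * t)))).
      replace (- INR (Datatypes.S m) * t) with (- (INR (Datatypes.S m) * t)) by ring.
      replace (- Re (c (Datatypes.S n) * cis (freq n * t)) / freq n ^ 2 * Re (w * cis (- (INR (Datatypes.S m) * t))))
        with (- (Re (c (Datatypes.S n) * cis (freq n * t)) * Re (w * cis (- (INR (Datatypes.S m) * t)))) / freq n ^ 2)
        by (field; lra).
      rewrite Re_mult_Re_cis.
      replace (freq n * t - INR (Datatypes.S m) * t) with (IZR (Z.of_nat n - Z.of_nat m) * t).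
      2:{ unfold freq. rewrite minus_IZR, <- !INR_IZR_INZ, !S_INR. ring. }
      replace (freq n * t + INR (Datatypes.S m) * t) with (IZR (Z.of_nat n + Z.of_nat m + 2) * t).
      2:{ unfold freq. rewrite !plus_IZR, <- !INR_IZR_INZ, !S_INR. ring. }
      eq_R. field. lra.
    - apply ex_RInt_cont; intros t.
      apply (continuous_plus
       (fun t => Re (c (Datatypes.S n) * w * cis (IZR (Z.of_nat n - Z.of_nat m) * t)))
       (fun t => Re (c (Datatypes.S n) * Cconj w * cis (IZR (Z.of_nat n + Z.of_nat m + 2) * t))));
      apply continuous_Re_cis. }
  assert (Z0 : forall n, n <> m -> RInt (u n) 0 (2 * PI) = 0).
  { intros n Hn. rewrite I, !RInt_Re_cis_0 by lia. eq_R. ring. }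
  rewrite (is_series_unique _ _ (is_series_single _ m Z0)).
  rewrite I, (RInt_Re_cis_0 _ (Z.of_nat m + Z.of_nat m + 2)) by lia.
  rewrite Z.sub_diag.
  rewrite (RInt_ext _ (fun _ => Re (c (Datatypes.S m) * w))).
  - replace (2 * PI) with (0 + 2 * PI) at 1 by ring. rewrite RInt_const_2PI.
    assert (Hf := freq_ge_1 m). field. lra.
  - intros t _. rewrite Rmult_0_l, cis_0, Cmult_1_r. reflexivity.
Qed.

(* Half-period shift: [cis (- n t)] changes sign under [t -> t + PI / n]. *)
Lemma fourier_holder (e : R -> R) (K alpha : R) (n : nat) (w : C) :
  (forall t, continuous e t) -> (forall t, e (t + 2 * PI) = e t) ->
  (forall s t, Rabs (e s - e t) <= K * Rpower (Rabs (s - t)) alpha) ->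
  (1 <= n)%nat -> Cmod w = 1 ->
  Rabs (fourier e n w) <= PI * (K * Rpower (PI / INR n) alpha).
Proof.
  intros Hc Hp HK Hn Hw.
  assert (HPI := PI_RGT_0).
  assert (Hn0 : 0 < INR n) by (apply lt_0_INR; lia).
  set (h := PI / INR n).
  assert (Hh : 0 < h) by (apply Rdiv_lt_0_compat; lra).
  set (f := fun t => e t * Re (w * cis (- INR n * t))).
  assert (Hcf : forall t, continuous f t).
  { intros t. apply continuous_Rmult; [apply Hc | apply continuous_Re_cis]. }
  assert (Hpf : forall t, f (t + 2 * PI) = f t).
  { intros t. unfold f. rewrite Hp. do 3 f_equal.
    replace (- INR n * (t + 2 * PI)) with (- INR n * t + 2 * IZR (- Z.of_nat n) * PI).
    - apply cis_2PI.
    - rewrite opp_IZR, <- INR_IZR_INZ. ring. }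
  assert (E1 : fourier e n w = RInt (fun t => f (t + h)) 0 (2 * PI)).
  { rewrite RInt_shift by exact Hcf. rewrite Rplus_0_l, (Rplus_comm _ h).
    now rewrite RInt_periodic. }
  assert (E2 : forall t, f (t + h) = - (e (t + h) * Re (w * cis (- INR n * t)))).
  { intros t. unfold f.
    replace (- INR n * (t + h)) with (- INR n * t + - PI) by (unfold h; field; lra).
    rewrite !Re_mult_cis, cos_plus, sin_plus, cos_neg, sin_neg, cos_PI, sin_PI. ring. }
  assert (Hcs : forall t, continuous (fun t => f (t + h)) t).
  { intros t. apply (continuous_comp (fun t => t + h) f); [|apply Hcf].
    apply (ex_derive_continuous (fun t => t + h)). auto_derive; auto. }
  assert (E3 : 2 * fourier e n w = RInt (fun t => (e t - e (t + h)) * Re (w * cis (- INR n * t))) 0 (2 * PI)).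
  { replace (2 * fourier e n w) with (fourier e n w + RInt (fun t => f (t + h)) 0 (2 * PI)) by lra.
    unfold fourier. rewrite <- (RInt_plus (V := R_CompleteNormedModule)) by (apply ex_RInt_cont; auto).
    apply RInt_ext. intros t _.
    change (e t * Re (w * cis (- INR n * t)) + f (t + h) = (e t - e (t + h)) * Re (w * cis (- INR n * t))).
    rewrite E2. ring. }
  assert (B : Rabs (2 * fourier e n w) <= (2 * PI - 0) * (K * Rpower h alpha)).
  { rewrite E3. apply abs_RInt_le_const; [lra | |].
    - apply ex_RInt_ext with (fun t => plus (f t) (f (t + h))).
      + intros t _.
        change (f t + f (t + h) = (e t - e (t + h)) * Re (w * cis (- INR n * t))).
        rewrite E2. unfold f. ring.
      + apply (ex_RInt_plus (V := R_NormedModule)); apply ex_RInt_cont; auto.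
    - intros t _. rewrite Rabs_mult.
      replace (Rpower h alpha) with (Rpower (Rabs (t - (t + h))) alpha).
      + rewrite <- (Rmult_1_r (K * _)). apply Rmult_le_compat; try apply Rabs_pos; auto.
        rewrite <- Hw. apply Re_mult_cis_le.
      + f_equal. replace (t - (t + h)) with (- h) by ring. rewrite Rabs_Ropp. apply Rabs_pos_eq; lra. }
  rewrite Rabs_mult, (Rabs_pos_eq 2) in B by lra. lra.
Qed.

(** * Condition numbers *)

Lemma continuous_Re (z : C) : continuous (fun z : C => Re z) z.
Proof. destruct z as [x y]. apply (continuous_fst x y). Qed.

Lemma is_derive_Re (f : R -> C) (t : R) (d : C) :
  is_derive f t d -> is_derive (fun s => Re (f s)) t (Re d).
Proof.
  intros H.
  apply (filterdiff_comp' f (fun z : C => Re z) t (fun y => scal y d) (fun z : C => Re z)).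
  - exact H.
  - apply (filterdiff_linear (fun z : C_R_NormedModule => Re z)).
    apply (is_linear_fst (K := R_AbsRing) (U := R_NormedModule) (V := R_NormedModule)).
Qed.

Lemma radial_abel (a : nat -> C) (R0 t : R) (gt : C) :
  0 < R0 -> CV_radius (fun k => Cmod (a k)) = Finite R0 ->
  filterlim (fun r : R => psum a (r * cis t)%C) (at_left R0) (locally gt) ->
  abel_tends (fun n => Re (a (S n) * RtoC (R0 ^ S n) * cis (freq n * t))) (Re gt - Re (a O)).
Proof.
  intros HR0 HR Hl eps He.
  assert (Hl' : filterlim (fun r : R => Re (psum a (r * cis t)%C)) (at_left R0) (locally (Re gt))).
  { apply (filterlim_comp _ _ _ _ (fun z : C => Re z) _ _ _ Hl). apply continuous_Re. }
  assert (Hb : locally (Re gt) (fun y => Rabs (y - Re gt) < eps)).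
  { exists (mkposreal eps He). intros y Hy. exact Hy. }
  destruct (Hl' _ Hb) as [d Hd].
  (* With [r = R0 e^{-x}], [R0 - r <= R0 x]. *)
  exists (d / R0). split; [apply Rdiv_lt_0_compat; [apply d | lra]|].
  intros x Hx. destruct (exp_lt_1 x (proj1 Hx)) as [H0 H1].
  assert (Hxd : R0 * x < d).
  { replace (pos d) with (R0 * (d / R0)) by (field; lra). apply Rmult_lt_compat_l; lra. }
  assert (Hex := exp_ineq1_le (- x)).
  set (r := R0 * exp (- x)).
  assert (Hr : 0 <= r < R0) by (unfold r; split; nra).
  specialize (Hd r).
  assert (Hball : ball R0 d r).
  { unfold ball; simpl; unfold AbsRing_ball, abs, minus, plus, opp; simpl.
    rewrite Rabs_left by lra. unfold r. nra. }
  specialize (Hd Hball (proj2 Hr)).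
  change (Rabs (Re (psum a (r * cis t)%C) - Re gt) < eps) in Hd.
  assert (Hs := summable_disc a R0 r HR Hr).
  rewrite psum_scale in Hd.
  rewrite <- (Cmult_1_r (psum _ _)), Re_psum_cis in Hd by exact Hs.
  assert (Hex2 : ex_series (fun k => Re (a k * RtoC (r ^ k) * 1 * cis (INR k * t)))).
  { apply (ex_series_dom _ (fun k => Cmod (a k * RtoC (r ^ k)))); [|exact Hs].
    intros k. rewrite Cmult_1_r. apply Re_mult_cis_le. }
  rewrite Series_incr_1 in Hd by exact Hex2.
  replace (Re (a 0%nat * RtoC (r ^ 0) * 1 * cis (INR 0 * t))) with (Re (a 0%nat)) in Hd.
  2:{ rewrite Rmult_0_l, cis_0, !Cmult_1_r. reflexivity. }
  rewrite (Series_ext _ (fun n => Re (a (S n) * RtoC (r ^ S n) * 1 * cis (INR (S n) * t)))).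
  - match goal with |- Rabs (?u - _) < _ => set (Y := u) in *; change (Rabs (Re (a 0%nat) + Y - Re gt) < eps) in Hd end.
    replace (Y - (Re gt - Re (a 0%nat))) with (Re (a 0%nat) + Y - Re gt) by ring. exact Hd.
  - intros n. unfold r. rewrite Rpow_mult_distr, pow_exp, RtoC_mult.
    unfold freq. set (q := exp _). rewrite !Re_mult_cis. destruct (a (S n)). simpl. ring.
Qed.

Lemma is_derive_RInt_continuous (f : R -> R) (t : R) :
  (forall s, continuous f s) -> is_derive (RInt f 0) t (f t).
Proof.
  intros Hf. apply (is_derive_RInt f (RInt f 0) 0 t); [|apply Hf].
  apply filter_forall. intros s. apply (RInt_correct (V := R_CompleteNormedModule)).
  now apply ex_RInt_cont.
Qed.

Lemma Cmod_Ci_pow (m : nat) : Cmod (Cpow Ci m) = 1.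
Proof. rewrite Cmod_pow, Cmod_Ci. apply pow1. Qed.

(** For [n >= 1], [b_n] is twice the [n]-th Fourier coefficient of [Re g], so real functions carry
    the argument. The factor [n^(k+2)] from the integrations by parts meets the [1 / n^2] of the
    Riemann function, leaving [|b_n| n^k <= K (PI / n)^alpha]. *)
Lemma coef_decay (a : nat -> C) (R0 L : R) (k : nat) (alpha : R) (g : R -> C) :
  0 < R0 -> CV_radius (fun k => Cmod (a k)) = Finite R0 -> M1_limit a R0 L ->
  (forall t, filterlim (fun r : R => psum a (r * cis t)%C) (at_left R0) (locally (g t))) ->
  C_k_alpha k alpha g ->
  exists K, 0 <= K /\ forall n, (1 <= n)%nat ->
    Cmod (a n) * R0 ^ n * Rpower (INR n) (INR k + alpha) <= K.
Proof.
  intros HR0 HR HL Hg [Hper [D [HD0 [HDd [HDc [K HK]]]]]].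
  assert (HPI := PI_RGT_0).
  set (c := fun n => (a n * RtoC (R0 ^ n))%C).
  assert (Hcm : forall n, Cmod (c n) = Cmod (a n) * R0 ^ n).
  { intros n. unfold c. rewrite Cmod_mult, Cmod_R, Rabs_pos_eq; auto. apply pow_le; lra. }
  assert (Hc : forall n, Cmod (c n) <= L).
  { intros n. rewrite Hcm. now apply H1_ge_coef. }
  set (d := fun j t => Re (D j t)).
  set (gamma := fun t => Re (g t) - Re (a O)).
  assert (Hdd : forall j t, (j < k)%nat -> is_derive (d j) t (d (S j) t)).
  { intros j t Hj. now apply is_derive_Re, HDd. }
  assert (Hdc : forall j t, (j <= k)%nat -> continuous (d j) t).
  { intros j t Hj. destruct (Nat.eq_dec j k) as [->|Hjk].
    - apply (continuous_comp (D k) (fun z : C => Re z)); [apply HDc | apply continuous_Re].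
    - apply (ex_derive_continuous (d j)). exists (d (S j) t). apply Hdd; lia. }
  assert (Hdp : forall j, (j <= k)%nat -> forall t, d j (t + 2 * PI) = d j t).
  { induction j as [|j IH]; intros Hj.
    - intros t. unfold d. now rewrite HD0, Hper.
    - apply (periodic_derive (d j)); [intros; apply Hdd; lia | apply IH; lia]. }
  assert (Hgam : forall t, gamma t = d O t - Re (a O)).
  { intros t. unfold gamma, d. now rewrite HD0. }
  assert (Hgc : forall t, continuous gamma t).
  { intros t. apply continuous_ext with (fun t => d O t - Re (a O)); [auto|].
    apply (continuous_minus (d O) (fun _ => Re (a O))); [apply Hdc; lia | apply continuous_const]. }
  set (G1 := RInt gamma 0). set (G := RInt G1 0).
  assert (HG1 : forall t, is_derive G1 t (gamma t)) by (intros; now apply is_derive_RInt_continuous).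
  assert (HG1c : forall t, continuous G1 t).
  { intros t. apply (ex_derive_continuous G1). now exists (gamma t). }
  assert (HG : forall t, is_derive G t (G1 t)) by (intros; now apply is_derive_RInt_continuous).
  (* The interval contains [[0, 2 PI]] in its interior, so that derivatives at the end points of the
     period are two-sided. *)
  destruct (riemann_fun_affine c L gamma G G1 (-1) (2 * PI + 1)) as [l1 [l0 Haff]]; auto; try lra.
  { intros t. assert (H := radial_abel a R0 t (g t) HR0 HR (Hg t)). exact H. }
  set (phi := riemann_fun c) in *. set (phi1 := fun t => G1 t + l1).
  assert (Hphi : forall t, 0 <= t <= 2 * PI -> is_derive phi t (phi1 t)).
  { intros t Ht. apply is_derive_ext_loc with (fun t => G t + l1 * t + l0).
    - exists (mkposreal 1 Rlt_0_1). intros s Hs.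
      unfold ball in Hs; simpl in Hs; unfold AbsRing_ball, abs, minus, plus, opp in Hs; simpl in Hs.
      apply Rabs_def2 in Hs. symmetry. apply Haff. lra.
    - unfold phi1. replace (G1 t + l1) with (plus (G1 t) l1) by reflexivity.
      apply is_derive_ext with (fun t => plus (G t) (l1 * t + l0)).
      { intros s. unfold plus; simpl. ring. }
      apply (is_derive_plus G (fun t => l1 * t + l0)); [apply HG|].
      auto_derive; auto. ring. }
  assert (Hphip : forall t, phi (t + 2 * PI) = phi t).
  { intros t. unfold phi, riemann_fun. apply Series_ext. intros n. do 4 f_equal.
    replace (freq n * (t + 2 * PI)) with (freq n * t + 2 * IZR (Z.of_nat (S n)) * PI).
    - apply cis_2PI.
    - rewrite <- INR_IZR_INZ. unfold freq. ring. }
  (* Nothing in the construction of [G1] makes [phi1] periodic; this is inherited from the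
     periodicity of the series [phi]. *)
  assert (Hphi1p : phi1 0 = phi1 (2 * PI)).
  { rewrite <- (is_derive_unique _ _ _ (Hphi 0 ltac:(lra))). apply is_derive_unique.
    apply is_derive_ext with (fun s => phi (s + 2 * PI)); [exact Hphip|].
    replace (phi1 (2 * PI)) with (1 * phi1 (0 + 2 * PI)) by (rewrite Rplus_0_l; ring).
    apply (is_derive_comp phi (fun s => s + 2 * PI)).
    - apply Hphi. lra.
    - auto_derive; auto. }
  (* The chain of derivatives starting at [phi]. Entry 2 differs from [d 0] by the constant
     [Re (a 0)], which affects neither derivatives nor increments. *)
  set (E := fun j => match j with
     | O => phi | 1%nat => phi1 | 2%nat => gamma | S (S i) => d i end).
  assert (EE : forall j, exists cst, forall t, E (S (S j)) t = d j t - cst).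
  { intros [|j]; [exists (Re (a O)); apply Hgam | exists 0; intros t; simpl; ring]. }
  assert (EEd : forall j t, (j < k)%nat -> is_derive (E (S (S j))) t (E (S (S (S j))) t)).
  { intros j t Hj. change (E (S (S (S j))) t) with (d (S j) t).
    destruct (EE j) as [cst Hcst].
    apply is_derive_ext with (fun t => minus (d j t) cst); [intros; now rewrite Hcst|].
    replace (d (S j) t) with (minus (d (S j) t) zero) by (unfold minus, plus, opp, zero; simpl; ring).
    apply (is_derive_minus (d j) (fun _ => cst)); [now apply Hdd | apply (is_derive_const cst)]. }
  assert (EEc : forall j t, (j <= k)%nat -> continuous (E (S (S j))) t).
  { intros j t Hj. destruct (EE j) as [cst Hcst].
    apply continuous_ext with (fun t => minus (d j t) cst); [intros; now rewrite Hcst|].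
    apply (continuous_minus (d j) (fun _ => cst)); [now apply Hdc | apply continuous_const]. }
  assert (EEp : forall j t, (j <= k)%nat -> E (S (S j)) (t + 2 * PI) = E (S (S j)) t).
  { intros j t Hj. destruct (EE j) as [cst Hcst]. rewrite !Hcst. now rewrite Hdp. }
  assert (HKd : forall s t, Rabs (E (S (S k)) s - E (S (S k)) t) <= K * Rpower (Rabs (s - t)) alpha).
  { intros s t. destruct (EE k) as [cst Hcst]. rewrite !Hcst.
    apply Rle_trans with (2 := HK s t).
    replace (d k s - cst - (d k t - cst)) with (Re (D k s - D k t)%C).
    - apply re_le_Cmod.
    - unfold d. destruct (D k s), (D k t). simpl. ring. }
  (* [Rpower] is an exponential, hence positive even at base 0, so the Hoelder bound at [s = t]
     fixes the sign of [K]. *)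
  assert (HK0 : 0 <= K).
  { assert (H := Rle_trans _ _ _ (Rabs_pos _) (HKd 0 0)). unfold Rpower in H.
    generalize (exp_pos (alpha * ln (Rabs (0 - 0)))). intros. nra. }
  exists (K * Rpower PI alpha). split.
  { apply Rmult_le_pos; [lra | left; apply exp_pos]. }
  intros [|m] Hm; [lia|].
  assert (Hf := freq_ge_1 m).
  destruct (phase_exists (c (S m))) as [w0 [Hw0 Ew0]].
  (* Cancels the factor [i^(k+2)] from the integrations by parts, as well as the phase of the
     coefficient. *)
  set (w := (Cconj (Cpow Ci (S (S k))) * w0)%C).
  assert (Hw : Cmod w = 1).
  { unfold w. now rewrite Cmod_mult, Cmod_conj, Cmod_Ci_pow, Hw0, Rmult_1_r. }
  assert (B := fourier_holder (E (S (S k))) K alpha (S m) w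
     (fun t => EEc k t (le_n _)) (fun t => EEp k t (le_n _)) HKd Hm Hw).
  rewrite (fourier_iter E (S (S k)) (S m) w) in B.
  - change (E O) with (riemann_fun c) in B. rewrite (fourier_riemann_fun c L m _ Hc) in B.
    replace (Re (c (S m) * (Cpow (Ci * INR (S m)) (S (S k)) * w)))
      with (Cmod (c (S m)) * freq m ^ S (S k)) in B.
    2:{ unfold w. rewrite Cpow_mult_l.
        replace (c (S m) * (Cpow Ci (S (S k)) * Cpow (INR (S m)) (S (S k)) * (Cconj (Cpow Ci (S (S k))) * w0)))%C
        with ((c (S m) * w0) * (Cpow Ci (S (S k)) * Cconj (Cpow Ci (S (S k)))) * Cpow (INR (S m)) (S (S k)))%C by ring.
        rewrite <- Cmod2_conj, Cmod_Ci_pow, Ew0, <- RtoC_pow, pow1.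
        fold (freq m). rewrite Cmult_1_r, <- RtoC_mult. reflexivity. }
    replace (- PI * (Cmod (c (S m)) * freq m ^ S (S k)) / freq m ^ 2)
      with (- (PI * (Cmod (c (S m)) * freq m ^ k))) in B by (simpl; field; lra).
    fold (freq m) in B.
    rewrite Rabs_Ropp, Rabs_pos_eq in B.
    2:{ apply Rmult_le_pos; [lra|]. apply Rmult_le_pos; [apply Cmod_ge_0 | apply pow_le; lra]. }
    apply Rmult_le_reg_l in B; [|lra].
    fold (freq m). rewrite <- Hcm, Rpower_plus, Rpower_pow by lra.
    assert (P1 : Rpower (PI / freq m) alpha * Rpower (freq m) alpha = Rpower PI alpha).
    { rewrite Rpower_mult_distr by (try apply Rdiv_lt_0_compat; lra). f_equal. field. lra. }
    rewrite <- P1, <- !Rmult_assoc.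
    apply Rmult_le_compat_r; [left; apply exp_pos | exact B].
  - intros j t Hj Ht. destruct j as [|[|j]].
    + now apply Hphi.
    + change (is_derive phi1 t (gamma t)). unfold phi1.
      replace (gamma t) with (plus (gamma t) zero) by (unfold plus, zero; simpl; ring).
      apply (is_derive_plus G1 (fun _ => l1)); [apply HG1 | apply (is_derive_const l1)].
    + apply EEd. lia.
  - intros j t Hj. destruct j as [|j].
    + apply (continuous_plus G1 (fun _ => l1)); [apply HG1c | apply continuous_const].
    + apply EEc. lia.
  - intros j Hj. destruct j as [|[|j]].
    + change (phi 0 = phi (2 * PI)). rewrite <- (Rplus_0_l (2 * PI)). symmetry. apply Hphip.
    + exact Hphi1p.
    + rewrite <- (Rplus_0_l (2 * PI)) at 1. symmetry. apply EEp. lia.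
Qed.

(** * From coefficient bounds to condition numbers *)

Lemma M1ext_ge_coef (a : nat -> C) (R0 L r : R) (n : nat) :
  0 < R0 -> CV_radius (fun k => Cmod (a k)) = Finite R0 -> M1_limit a R0 L ->
  0 < r <= R0 -> Cmod (a n) * r ^ n <= M1ext a R0 L r.
Proof.
  intros HR0 HR HL Hr. unfold M1ext. destruct (Rlt_dec r R0) as [H|H].
  - apply M1_ge_coef with R0; auto. lra.
  - replace r with R0 by lra. now apply H1_ge_coef.
Qed.

Lemma kappa_star_ge_intro (a : nat -> C) (R0 L M : R) (n : nat) :
  (forall r, 0 < r <= R0 -> M * (Cmod (a n) * r ^ n) <= M1ext a R0 L r) ->
  kappa_star_ge a R0 L n M.
Proof.
  intros H r Hr. unfold kappa. destruct (Req_EM_T (Cmod (a n)) 0) as [E|E]; [exact I|].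
  simpl. assert (Ha := Cmod_ge_0 (a n)).
  assert (P : 0 < Cmod (a n) * r ^ n).
  { apply Rmult_lt_0_compat; [lra | apply pow_lt; lra]. }
  apply Rmult_le_reg_r with (1 := P). unfold Rdiv.
  rewrite Rmult_assoc, Rinv_l, Rmult_1_r by lra. auto.
Qed.

(** For [n >= m] the quotient of [|a_m| r^m] by [|a_n| r^n] does not increase with [r], so [r = R0]
    is the worst case. *)
Lemma kappa_star_ge_ratio (a : nat -> C) (R0 L M : R) (m n : nat) :
  0 < R0 -> CV_radius (fun k => Cmod (a k)) = Finite R0 -> M1_limit a R0 L ->
  (m <= n)%nat -> 0 <= M ->
  M * (Cmod (a n) * R0 ^ n) <= Cmod (a m) * R0 ^ m -> kappa_star_ge a R0 L n M.
Proof.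
  intros HR0 HR HL Hmn HM H. apply kappa_star_ge_intro. intros r Hr.
  apply Rle_trans with (2 := M1ext_ge_coef a R0 L r m HR0 HR HL Hr).
  assert (Hn : n = (m + (n - m))%nat) by lia.
  assert (P : 0 < R0 ^ m) by (apply pow_lt; lra).
  assert (Pr : 0 < r ^ m) by (apply pow_lt; lra).
  assert (Q : r ^ (n - m) <= R0 ^ (n - m)) by (apply pow_incr; lra).
  assert (H' : M * (Cmod (a n) * R0 ^ (n - m)) <= Cmod (a m)).
  { rewrite Hn in H at 2. rewrite pow_add in H.
    apply Rmult_le_reg_r with (1 := P). lra. }
  replace (r ^ n) with (r ^ m * r ^ (n - m)) by (rewrite <- pow_add; f_equal; lia).
  replace (M * (Cmod (a n) * (r ^ m * r ^ (n - m))))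
    with (M * (Cmod (a n) * r ^ (n - m)) * r ^ m) by ring.
  apply Rmult_le_compat_r; [lra|]. apply Rle_trans with (2 := H').
  apply Rmult_le_compat_l; [lra|]. apply Rmult_le_compat_l; [apply Cmod_ge_0 | exact Q].
Qed.

(** The zero series would have infinite radius of convergence. *)
Lemma coef_neq_0 (a : nat -> C) (R0 : R) :
  CV_radius (fun k => Cmod (a k)) = Finite R0 -> exists m, 0 < Cmod (a m).
Proof.
  intros HR. apply NNPP. intros Hno.
  assert (H : CV_radius (fun k => Cmod (a k)) = CV_radius (fun _ => 0)).
  { apply CV_radius_ext. intros n. apply Rle_antisym; [|apply Cmod_ge_0].
    apply Rnot_lt_le. intros Hn. apply Hno. now exists n. }
  rewrite HR, CV_radius_const_0 in H. discriminate.
Qed.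

Theorem theorem4p7 (a : nat -> C) (R0 : R) :
  0 < R0 ->
  CV_radius (fun k => Cmod (a k)) = Finite R0 ->
  forall L : R, M1_limit a R0 L ->
  (forall M : R, exists N : nat, forall n : nat, (N <= n)%nat ->
      kappa_star_ge a R0 L n M) /\
  (forall (k : nat) (alpha : R) (g : R -> C),
      0 <= alpha <= 1 ->
      (forall t, filterlim (fun r : R => psum a (r * cis t)%C) (at_left R0) (locally (g t))) ->
      C_k_alpha k alpha g ->
      exists c : R, 0 < c /\
        forall n : nat, (1 <= n)%nat ->
          kappa_star_ge a R0 L n (c * Rpower (INR n) (INR k + alpha))).
Proof.
  intros HR0 HR L HL.
  destruct (coef_neq_0 a R0 HR) as [m Hm].
  assert (Hbm : 0 < Cmod (a m) * R0 ^ m) by (apply Rmult_lt_0_compat; [|apply pow_lt]; lra).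
  set (bm := Cmod (a m) * R0 ^ m) in *.
  assert (Hpos : forall n, 0 <= Cmod (a n) * R0 ^ n).
  { intros n. apply Rmult_le_pos; [apply Cmod_ge_0 | apply pow_le; lra]. }
  split.
  - intros M. assert (HM := Rabs_pos M).
    destruct (H1_coef_to_0 a R0 L (bm / (Rabs M + 1)) HR0 HR HL) as [N HN].
    { apply Rdiv_lt_0_compat; lra. }
    exists (N + m)%nat. intros n Hn r Hr.
    apply Rbar_le_trans with (Finite (Rabs M)); [apply Rle_abs|].
    revert r Hr. change (kappa_star_ge a R0 L n (Rabs M)).
    apply (kappa_star_ge_ratio a R0 L (Rabs M) m n); auto; try lia. fold bm.
    assert (Hn' := HN n ltac:(lia)). specialize (Hpos n).
    set (bn := Cmod (a n) * R0 ^ n) in *.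
    apply Rle_trans with ((Rabs M + 1) * (bm / (Rabs M + 1))).
    + apply Rmult_le_compat; lra.
    + right. field. lra.
  - intros k alpha g Halpha Hg HC.
    destruct (coef_decay a R0 L k alpha g HR0 HR HL Hg HC) as [K [HK HKn]].
    set (s := INR k + alpha) in *.
    assert (Hs : 0 <= s) by (unfold s; generalize (pos_INR k); lra).
    set (q := Rpower (INR (S m)) s).
    assert (Hq : 0 < q) by apply exp_pos.
    (* The first bound serves [n >= m]. For the finitely many [n < m], Cauchy's estimate for [a n]
       itself gives [kappa >= 1], and [n^s <= q] makes the required bound at most 1. *)
    set (c := Rmin (bm / (K + 1)) (/ q)).
    assert (Hc : 0 < c).
    { apply Rmin_glb_lt; [apply Rdiv_lt_0_compat; lra | now apply Rinv_0_lt_compat]. }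
    assert (Hc1 : c <= bm / (K + 1)) by apply Rmin_l.
    assert (Hc2 : c <= / q) by apply Rmin_r.
    exists c. split; [exact Hc|]. intros n Hn.
    assert (Hp : 0 < Rpower (INR n) s) by apply exp_pos.
    destruct (le_dec m n) as [Hmn|Hmn].
    + apply (kappa_star_ge_ratio a R0 L _ m n); auto; [nra|]. fold bm.
      assert (Hkn := HKn n Hn). specialize (Hpos n).
      replace (c * Rpower (INR n) s * (Cmod (a n) * R0 ^ n))
        with (c * (Cmod (a n) * R0 ^ n * Rpower (INR n) s)) by ring.
      apply Rle_trans with (bm / (K + 1) * (K + 1)).
      * apply Rmult_le_compat; try lra. apply Rmult_le_pos; lra.
      * right. field. lra.
    + apply kappa_star_ge_intro. intros r Hr.
      apply Rle_trans with (2 := M1ext_ge_coef a R0 L r n HR0 HR HL Hr).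
      assert (P : 0 <= Cmod (a n) * r ^ n).
      { apply Rmult_le_pos; [apply Cmod_ge_0 | apply pow_le; lra]. }
      assert (Q : Rpower (INR n) s <= q).
      { apply Rle_Rpower_l; [exact Hs|]. split; [apply lt_0_INR; lia | apply le_INR; lia]. }
      assert (c * Rpower (INR n) s <= 1).
      { rewrite <- (Rinv_l q) by lra. apply Rmult_le_compat; lra. }
      nra.
Qed.
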